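(* Let $Q$ be a network with root $O$ (satisfying the standing assumption in the context), let $\rho=\rho(Q)$ be its randomized pathwise competitive ratio, and let $s$ be the pathwise random doubling strategy on $Q$ defined in the context. Then $s$ is a $5$-approximation for the optimal randomized pathwise search, that is, $$\rho_s(Q)\le 5\,\rho(Q).$$
   Context: A network $Q$ is a connected metric graph made of vertices and arcs (possibly unbounded), with a distinguished root vertex $O$, endowed with Lebesgue (length) measure $\lambda$. $d(x,y)$ is the length of a shortest path from $x$ to $y$, and $d(x)=d(O,x)$. Standing assumption: there is an integer $N$ such that $|\{x\in Q: d(x)=r\}|\le N$ for all $r>0$. A pathwise search is a map $S:[0,\infty)\to Q$ with $S(0)=O$ and $d(S(t_1),S(t_2))\le t_2-t_1$ for all $t_1<t_2$. The search time of $H\in Q$ is $T(S,H)=\min\{t\ge0: S(t)=H\}$ ($\infty$ if $H$ is never reached); the normalized search time is $\hat T(S,H)=T(S,H)/d(H)$ for $H\neq O$, and $\hat T(S,O)=0$. A randomized search $s$ is a probability distribution over pathwise searches; $\hat T(s,H)$ is the expected normalized search time; $\rho_s(Q)=\sup_{H\in Q}\hat T(s,H)$ and $\rho(Q)=\inf_s\rho_s(Q)$ over all randomized pathwise searches. Shortest path tree: $Q_T$ is the rooted (metric) tree obtained from $Q$ by cutting it at points reached by more than one shortest path from $O$, so that every point $x$ of $Q_T$ is joined to $O$ by a unique path, of length $d(x)$; the cutting does not change the measure. A search of $Q_T$ naturally gives a search of $Q$. Pathwise Randomized Depth-First Search (RDFS): for a rooted tree $\mathcal T$ of finite length, let $S$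 be any unit-speed depth-first tour of $\mathcal T$ that starts at the root, visits all leaves, and returns to the root (so has length $2\lambda(\mathcal T)$), and let $S^{-1}$ be the reverse tour. An RDFS chooses $S$ or $S^{-1}$ with probability $1/2$ each. Pathwise random doubling strategy: for each $j\in\mathbb Z$ choose $d_j$ uniformly at random in $[2^{j-1},2^j]$, independently over $j$, and set $R_j=\{x\in Q_T: d_j\le d(x)<d_{j+1}\}$. The strategy performs, successively in increasing order of $j\in\mathbb Z$ (thus starting with infinitely many infinitesimally small tours), an RDFS of the tree $\{O\}\cup\bigcup_{i\le j}R_i$ (with fair coins independent of the $d_i$). *)

(* Defs.v *)
From HB Require Import structures.
From mathcomp Require Import all_boot all_order all_algebra.
From mathcomp Require Import all_classical all_reals all_analysis.

Set Implicit Arguments.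
Unset Strict Implicit.
Unset Printing Implicit Defensive.

Import Order.TTheory GRing.Theory Num.Theory.
Import numFieldNormedType.Exports.

Local Open Scope classical_set_scope.
Local Open Scope card_scope.
Local Open Scope ring_scope.

(* Loops, parallel arcs and infinitely many arcs are allowed.  An arc [e] starts
   at [tail e]; [far_end e = Some (v, l)] is an arc of length [l] ending at [v],
   [far_end e = None] is an unbounded arc, isometric to a half-line. *)
Record metric_graph (R : realType) := MetricGraph {
  vertex : Type;
  arc : Type;
  root : vertex;
  tail : arc -> vertex;
  far_end : arc -> option (vertex * {posnum R}) }.

Section Network.
Variables (R : realType) (Q : metric_graph R).

Definition interior_pos (e : arc Q) (t : R) : bool :=
  (0 < t) && (if far_end e is Some (_, l) then t < l%:num else true).

Inductive point : Type :=
| Vertex of vertex Q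
| Inner (e : arc Q) (t : R) of interior_pos e t.

Definition O : point := Vertex (root Q).

(* [x] is the point of the closed arc [e] at distance [t] from the tail, measured
   along [e]; the vertex of a loop has two positions. *)
Definition at_pos (e : arc Q) (t : R) (x : point) : Prop :=
  match x with
  | Vertex v => (t = 0 /\ tail e = v)
      \/ (exists2 l : {posnum R}, far_end e = Some (v, l) & t = l%:num)
  | @Inner e' t' _ => e' = e /\ t' = t
  end.

(* [walk x y l]: some concatenation of segments of arcs, of total length [l],
   leads from [x] to [y]. *)
Inductive walk : point -> point -> R -> Prop :=
| walk_nil x : walk x x 0
| walk_cons e a b x y z l :
    at_pos e a x -> at_pos e b y -> walk y z l -> walk x z (`|a - b| + l).

Definition connected_graph : Prop := forall x y, exists l, walk x y l.

(* Under [levels_bounded_by] the infimum is attained by a shortest path. *)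
Definition dist (x y : point) : R := inf [set l | walk x y l].

Definition depth (x : point) : R := dist O x.

Definition levels_bounded_by (N : nat) : Prop :=
  forall r : R, 0 < r -> [set x | depth x = r] #<= `I_N.

Lemma walk_ge0 x y l : walk x y l -> 0 <= l.
Proof. by elim=> // *; rewrite addr_ge0. Qed.

Lemma dist_xx_le0 x : dist x x <= 0.
Proof.
apply: ge_inf; last exact: walk_nil.
by exists 0 => l /walk_ge0.
Qed.

(* The values of [trace] at negative times are irrelevant. *)
Record search := Search {
  trace :> R -> point;
  trace0 : trace 0 = O;
  trace_lip : forall t1 t2 : R,
    0 <= t1 -> t1 < t2 -> dist (trace t1) (trace t2) <= t2 - t1 }.

HB.instance Definition _ := gen_eqMixin search.
HB.instance Definition _ := gen_choiceMixin search.

Lemma still_lip (t1 t2 : R) : 0 <= t1 -> t1 < t2 -> dist O O <= t2 - t1.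
Proof. by move=> _ /ltW; rewrite -subr_ge0; exact/le_trans/dist_xx_le0. Qed.

HB.instance Definition _ :=
  isPointed.Build search (@Search (fun=> O) erefl still_lip).

(* The sigma-algebra generated by the positions [S t], [t >= 0]. *)
Definition position_events : set (set search) :=
  [set E | exists t x r, 0 <= t /\ E = [set S : search | dist (S t) x < r]].

Definition search_space := g_sigma_algebraType position_events.
HB.instance Definition _ := Measurable.on search_space.

Local Open Scope ereal_scope.

Definition search_time (S : search) (H : point) : \bar R :=
  ereal_inf [set t%:E | t in [set t : R | (0 <= t)%R /\ S t = H]].

Definition normalized_search_time (S : search) (H : point) : \bar R :=
  if `[< H = O >] then 0 else search_time S H * ((depth H)^-1)%:E.

Definition randomized_search := probability search_space R.

Definition expected_normalized_time (s : randomized_search) (H : point) :=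
  \int[s]_(S in setT) normalized_search_time S H.

Definition competitive_ratio_of (s : randomized_search) : \bar R :=
  ereal_sup (range (expected_normalized_time s)).

Definition competitive_ratio : \bar R := ereal_inf (range competitive_ratio_of).

Local Close Scope ereal_scope.

(* Shortest paths from [O], parametrized by arc length; the values outside
   [0, plen] are fixed so that equality is equality of paths. *)
Record spath := SPath {
  plen : R;
  pfun :> R -> point;
  plen_ge0 : 0 <= plen;
  pfun0 : pfun 0 = O;
  pfun_dist : forall a b, 0 <= a -> a <= b -> b <= plen ->
    dist (pfun a) (pfun b) = b - a;
  pfun_out : forall t, t < 0 \/ plen < t -> pfun t = O }.

Definition pend (p : spath) : point := p (plen p).

Definition agree_on (p q : spath) (a b : R) : Prop :=
  forall t, a <= t <= b -> p t = q t.

Definition prefix_of (p q : spath) : Prop :=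
  plen p <= plen q /\ agree_on p q 0 (plen p).

(* A point of a shortest path tree is identified with the unique path that joins
   it to the root, so that a tree is a set [G] of shortest paths; [prefix_of] is
   then the ancestor relation, and [pend] the projection to the network.  The
   tree arises from the network by cutting alone: no point is lost ([spt_onto]),
   all cut ends are kept ([spt_closed]), and only isolated points are duplicated,
   since two branches containing a common nondegenerate segment of the network
   coincide up to that segment ([spt_cut]).  Where a vertex is reached by several
   shortest paths, the tree is not unique. *)
Record shortest_path_tree (G : set spath) : Prop := {
  spt_prefix : forall p q, G q -> prefix_of p q -> G p;
  spt_closed : forall q,
    (forall p, prefix_of p q -> plen p < plen q -> G p) -> G q;
  spt_onto : forall x, exists2 p, G p & pend p = x;
  spt_cut : forall p q a b, G p -> G q -> 0 <= a -> a < b ->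
    b <= plen p -> b <= plen q -> agree_on p q a b -> agree_on p q 0 a }.

Definition meet_depth (p q : spath) : R :=
  sup [set u | [/\ 0 <= u, u <= plen p, u <= plen q & agree_on p q 0 u]].

Definition tree_dist (p q : spath) : R :=
  plen p + plen q - (meet_depth p q) *+ 2.

(* [T] together with the upper end points of its branches. *)
Definition tree_closure (T : set spath) : set spath :=
  [set q | forall p, prefix_of p q -> plen p < plen q -> T p].

Definition leaf (T : set spath) (p : spath) : Prop :=
  tree_closure T p /\ forall q, tree_closure T q -> prefix_of p q -> q = p.

Definition unit_speed (L : R) (tau : R -> spath) : Prop :=
  forall t, 0 <= t <= L -> exists2 eps : R, 0 < eps &
    forall u, 0 <= u <= L -> `|u - t| < eps ->
      tree_dist (tau t) (tau u) = `|u - t|.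

(* The subtree above each [p] is explored during a single interval of time:
   together with unit speed and visiting all leaves, every segment is traversed
   exactly once in each direction, so that [L] is twice the length of the tree. *)
Definition depth_first (L : R) (tau : R -> spath) : Prop :=
  forall p t1 t2 t3, 0 <= t1 -> t1 <= t2 -> t2 <= t3 -> t3 <= L ->
    prefix_of p (tau t1) -> prefix_of p (tau t3) -> prefix_of p (tau t2).

(* A tour is given by its duration and its position at each time. *)
Definition tour := (R * (R -> spath))%type.

Record depth_first_tour (T : set spath) (S : tour) : Prop := {
  dft_dur : 0 <= S.1;
  dft_in : forall t, 0 <= t <= S.1 -> tree_closure T (S.2 t);
  dft_start : plen (S.2 0) = 0;
  dft_end : plen (S.2 S.1) = 0;
  dft_speed : unit_speed S.1 S.2;
  dft_order : depth_first S.1 S.2;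
  dft_leaves : forall p, leaf T p -> exists2 t, 0 <= t <= S.1 & S.2 t = p }.

Definition reverse_tour (S : tour) : tour := (S.1, fun t => S.2 (S.1 - t)).

(* The random choices: the radii [d_j] and the coins, for all [j : int]. *)
Definition choices := ((int -> R) * (int -> bool))%type.

Definition choice_events : set (set choices) :=
  [set E | exists j, (exists2 B : set R, measurable B &
                        E = [set w : choices | B (w.1 j)])
                  \/ E = [set w : choices | w.2 j]].

Definition choice_space := g_sigma_algebraType choice_events.
HB.instance Definition _ := Measurable.on choice_space.

Lemma dyadic_lt (j : int) : (2 : R) ^ (j - 1) < 2 ^ j.
Proof. by rewrite ltr_eXz2l ?ltr1n// ltrBlDr ltrDl. Qed.

(* The product law: all choices are mutually independent, [d_j] is uniform on
   [2^(j-1), 2^j] and each coin is fair. *)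
Definition doubling_law (P : probability choice_space R) : Prop :=
  forall (J : seq int) (B : int -> set R) (C : int -> set bool), uniq J ->
    (forall j, measurable (B j)) ->
    P [set w | forall j, j \in J -> B j (w.1 j) /\ C j (w.2 j)]
    = (\prod_(j <- J) (uniform_prob (dyadic_lt j) (B j) *
                       bernoulli_prob (2^-1) (C j)))%E.

Definition shell (G : set spath) (d : int -> R) (j : int) : set spath :=
  [set p | G p /\ d j <= plen p < d (j + 1)].

Definition doubling_tree (G : set spath) (d : int -> R) (j : int) : set spath :=
  [set p | plen p = 0] `|` \bigcup_(i in [set i | i <= j]) shell G d i.

(* [S] performs the tours [tours j] successively in increasing order of
   [j : int]; tour [j] starts at time [start j]. *)
Definition performs (tours : int -> tour) (S : search) : Prop :=
  exists start : int -> R,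
    [/\ (fun n : nat => start (- n%:Z)) @ \oo --> (0 : R),
        forall j, start (j + 1) = start j + (tours j).1 &
        forall j t, 0 <= t <= (tours j).1 ->
          S (start j + t) = pend ((tours j).2 t)].

(* [tau j T] is the depth-first tour used in round [j] if the tree is [T]; it is
   fixed in advance, hence independent of the coins.  The randomized search [s]
   is the law of the resulting search [sigma w].  Since [sigma] lives on the
   canonical space of choices, its measurability also forbids that [tau] correlates
   with the coins through a non-measurable dependence on the radii. *)
Definition random_doubling (s : randomized_search) : Prop :=
  exists (G : set spath) (tau : int -> set spath -> tour)
         (P : probability choice_space R)
         (sigma : choice_space -> search_space),
    [/\ shortest_path_tree G,
        doubling_law P,
        measurable_fun setT sigma,
        forall w : choices, (forall j, 2 ^ (j - 1) <= w.1 j <= 2 ^ j) ->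
          let tau_w j := tau j (doubling_tree G w.1 j) in
          (forall j, depth_first_tour (doubling_tree G w.1 j) (tau_w j)) /\
          performs (fun j => if w.2 j then tau_w j else reverse_tour (tau_w j))
                   (sigma w) &
        forall B, measurable B -> s B = P (sigma @^-1` B)].

End Network.

(* Main.v *)
Require Import Defs.
From HB Require Import structures.
From mathcomp Require Import all_boot all_order all_algebra.
From mathcomp Require Import all_classical all_reals all_analysis.
From mathcomp Require Import measurable_realfun measurable_fun_approximation.
From mathcomp Require Import ring lra.
(* Once more, so that [arc], [root] and [point] are those of a network. *)
Require Import Defs.

Set Implicit Arguments.
Unset Strict Implicit.
Unset Printing Implicit Defensive.

Import Order.TTheory GRing.Theory Num.Theory.
Import numFieldNormedType.Exports.

Local Open Scope classical_set_scope.
Local Open Scope card_scope.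
Local Open Scope ring_scope.

(** The comparison between the doubling strategy and an arbitrary search rests on a
    single function of the network, the total length [L r] of its part at depth at
    most [r].

    A lower bound for every search.  Suppose that a randomized search reaches each
    point [x] within expected time [c * depth x].  Take points of depth at most [r]
    at mutual distance at least [d] that sample the length evenly.  A searcher
    needs time [d] between any two of them, so that the sum of the [m] search times
    is at least [d * m * (m - 1) / 2]; comparing with [c] times the sum of the
    depths and letting [d] tend to 0 gives
      [c * r * L r - (c * r)^2 / 2 <= c * (r * L r - A r)],
    that is [A r <= c * r^2 / 2], where [A r] is the integral of [L] over [[0, r]]
    ([separated_points_bound], [length_area_bound]).

    An upper bound for the strategy.  A depth-first tour of the tree cut at depth
    [r] lasts [2 * L r] at most ([tour_duration]).  A point of depth [h] with
    [2^(k-1) <= h < 2^k] is found in round [k - 1] if [h < d_k] and in round [k]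
    otherwise; flipping all coins preserves the law and reverses the tour of that
    round, so that on average the point is found after half of that tour
    ([flipped_runs_cost], [integral_le_flip_average]).  As [d_j] is uniform on
    [[2^(j-1), 2^j]], the expectation of [L d_j] is a difference of two values of
    [A] divided by [2^(j-1)].  After summation by parts the expected time becomes a
    combination of values of [A] with nonnegative coefficients, and the bound on [A]
    turns it into at most [9/2 * c * h] ([expected_search_cost]).

    Two features of the general setting need care.  The tree is cut at possibly
    infinitely many points, and its points are paths; that tour lengths in the tree
    are controlled by lengths in the network relies on the decomposition of the arcs
    into halves along which the depth rises.  There are countably many halves,
    all but countably many levels meet the network inside halves only
    ([depth_in_half]), and there a point of the network has only one
    preimage in the tree ([pend_inj]).  Moreover a depth-first tour
    is only required to visit the leaves, and a branch that has no end has no leaf; but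
    then no search has finite ratio ([finite_ratio_rays_end]). *)

(** * Distances in a metric graph *)

Section Distance.
Variables (R : realType) (Q : metric_graph R).
Hypothesis Qc : connected_graph Q.
Implicit Types (x y z : point Q) (e : arc Q).

Lemma walk_cat x y z a b : walk x y a -> walk y z b -> walk x z (a + b).
Proof.
move=> w; elim: w z b => [x'|e p q x1 y1 z1 l px qy _ IH] z b w2; first by rewrite add0r.
by rewrite -addrA; apply: (walk_cons px qy); exact: IH.
Qed.

Lemma walk_rev x y a : walk x y a -> walk y x a.
Proof.
elim=> [z|e p q x1 y1 z1 l px qy _ IH]; first exact: walk_nil.
rewrite addrC; apply: walk_cat IH _; rewrite distrC -[`|_|]addr0.
exact: walk_cons qy px (walk_nil _).
Qed.

Lemma walks_lbound x y : has_lbound [set l | walk x y l].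
Proof. by exists 0 => l /walk_ge0. Qed.

Lemma dist_le x y l : walk x y l -> dist x y <= l.
Proof. by move=> w; apply: ge_inf => //; exact: walks_lbound. Qed.

Lemma dist_ge x y c : (forall l, walk x y l -> c <= l) -> c <= dist x y.
Proof. by move=> h; apply: lb_le_inf; [exact: Qc | move=> l /h]. Qed.

Lemma dist_ge0 x y : 0 <= dist x y.
Proof. by apply: dist_ge => l /walk_ge0. Qed.

Lemma distxx x : dist x x = 0.
Proof. by apply/eqP; rewrite eq_le dist_xx_le0 dist_ge0. Qed.

Lemma dist_sym x y : dist x y = dist y x.
Proof.
by apply/eqP; rewrite eq_le; apply/andP; split; apply: dist_ge => l /walk_rev; exact: dist_le.
Qed.

Lemma dist_triangle y x z : dist x z <= dist x y + dist y z.
Proof.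
rewrite -lerBlDl; apply: dist_ge => l w; rewrite lerBlDl -lerBlDr.
by apply: dist_ge => k v; rewrite lerBlDr; apply/dist_le/walk_cat/w.
Qed.

Lemma dist_arc e a b x y : at_pos e a x -> at_pos e b y -> dist x y <= `|a - b|.
Proof.
by move=> xa yb; rewrite -[`|_|]addr0; apply/dist_le/(walk_cons xa yb)/walk_nil.
Qed.

Definition arc_lipschitz (F : point Q -> R) :=
  forall e a b x y, at_pos e a x -> at_pos e b y -> F x - F y <= `|a - b|.

(** The device for all lower bounds on distances: a function that changes at
    most at unit speed along every arc bounds the length of every walk. *)
Lemma lipschitz_dist F x y : arc_lipschitz F -> F x - F y <= dist x y.
Proof.
move=> FL; apply: dist_ge => l; elim=> [z|e a b x1 y1 z1 k xa yb _ IH].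
  by rewrite subrr.
by have := FL _ _ _ _ _ xa yb; lra.
Qed.

Definition arc_fun (fv : vertex Q -> R) (fe : arc Q -> R -> R) x : R :=
  match x with Vertex v => fv v | @Inner _ _ e t _ => fe e t end.

Definition on_arc e (t : R) : bool :=
  (0 <= t) && (if far_end e is Some (_, l) then t <= l%:num else true).

Lemma at_pos_on_arc e t x : at_pos e t x -> on_arc e t.
Proof.
rewrite /on_arc; case: x => [v|e' t' it] /=.
  move=> [[t0 _]|[l -> ->]]; last by apply/andP; split.
  by rewrite t0 lexx /=; case: (far_end e) => // -[? l'].
case=> <- <-; move: it; rewrite /interior_pos.
by case: (far_end _) => [[? l]|] /andP[/ltW ->]// /ltW.
Qed.

Definition ends_match (fv : vertex Q -> R) (fe : arc Q -> R -> R) :=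
  forall e, fe e 0 = fv (tail e) /\
    forall v l, far_end e = Some (v, l) -> fe e l%:num = fv v.

Lemma arc_funE fv fe e t x : ends_match fv fe -> at_pos e t x ->
  arc_fun fv fe x = fe e t.
Proof.
move=> m; case: x => [v|e' t' it] /=.
  by have [m0 m1] := m e; case=> [[-> <-]|[l /m1 <- ->]].
by case=> -> ->.
Qed.

Lemma arc_fun_lipschitz fv fe : ends_match fv fe ->
  (forall e a b, on_arc e a -> on_arc e b -> fe e a - fe e b <= `|a - b|) ->
  arc_lipschitz (arc_fun fv fe).
Proof.
move=> m L e a b x y xa yb; rewrite !(arc_funE m xa, arc_funE m yb).
by apply: L; [exact: at_pos_on_arc xa|exact: at_pos_on_arc yb].
Qed.

Lemma at_tail e : at_pos e 0 (Vertex (tail e)).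
Proof. by left. Qed.

Lemma at_far e v (l : {posnum R}) : far_end e = Some (v, l) -> at_pos e l%:num (Vertex v).
Proof. by right; exists l. Qed.

Lemma posnumP (l : {posnum R}) : 0 < l%:num.
Proof. by []. Qed.

(** As a 1-Lipschitz function that vanishes off an arc, [bump] shows that leaving a
    segment of the arc costs at least the distance to the ends of the segment. *)
Definition bump e0 (t0 c : R) : point Q -> R :=
  arc_fun (fun=> 0) (fun e t => if `[< e = e0 >] then Num.max 0 (c - `|t - t0|) else 0).

Lemma bump_lipschitz e0 t0 c : 0 <= c -> on_arc e0 (t0 - c) -> on_arc e0 (t0 + c) ->
  arc_lipschitz (bump e0 t0 c).
Proof.
move=> c0 oa ob; apply: arc_fun_lipschitz.
  move=> e; case: (asboolP (e = e0)) => [->|]; last by [].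
  move: oa ob; rewrite /on_arc; case E: (far_end e0) => [[v l]|] /andP[h1 h2] /andP[h3 h4].
    split=> [|v' l' [_ <-]]; apply/max_idPl.
      by rewrite sub0r normrN ger0_norm; lra.
    by rewrite ger0_norm; lra.
  by split=> //; apply/max_idPl; rewrite sub0r normrN ger0_norm; lra.
move=> e a b _ _; case: asboolP => _; last by rewrite subrr.
have := ler_distD a b t0; rewrite (distrC b a).
by case: (leP 0 (c - `|a - t0|)) => ?; case: (leP 0 (c - `|b - t0|)) => ?; have := normr_ge0 (a - b); lra.
Qed.

Lemma depthO : depth (O Q) = 0.
Proof. exact: distxx. Qed.

Lemma depth_ge0 x : 0 <= depth x.
Proof. exact: dist_ge0. Qed.

Lemma depth_dist x y : depth x - depth y <= dist x y.
Proof. by rewrite lerBlDl (dist_sym x); exact: dist_triangle. Qed.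

Definition rise (h : arc Q * bool) (a : R) : R :=
  if h.2 then if far_end h.1 is Some (v, l) then depth (Vertex v) + l%:num - a else 0
  else depth (Vertex (tail h.1)) + a.

Definition arc_depth e a : R :=
  if far_end e is Some _ then Num.min (rise (e, false) a) (rise (e, true) a)
  else rise (e, false) a.

Lemma arc_depth_lipschitz e a b : arc_depth e a - arc_depth e b <= `|a - b|.
Proof.
have h1 := ler_norm (a - b); have := ler_norm (b - a); rewrite distrC => h2.
rewrite /arc_depth /rise /=; case: (far_end e) => [[v l]|]; last lra.
by rewrite !minElt; case: ltP => ?; case: ltP => ?; lra.
Qed.

Lemma arc_depth_ends : ends_match (fun v => depth (Vertex v)) arc_depth.
Proof.
move=> e; rewrite /arc_depth /rise /=; split.
  case E: (far_end e) => [[v l]|]; last by rewrite addr0.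
  rewrite subr0 addr0; apply/min_idPl; rewrite -lerBlDl.
  apply: le_trans (depth_dist _ _) _; apply: le_trans (dist_arc (at_tail e) (at_far E)) _.
  by rewrite sub0r normrN ger0_norm.
move=> v l E; rewrite E addrK; apply/min_idPr; rewrite -lerBlDl.
apply: le_trans (depth_dist _ _) _; apply: le_trans (dist_arc (at_far E) (at_tail e)) _.
by rewrite subr0 ger0_norm.
Qed.

Lemma depth_at e a x : at_pos e a x -> depth x = arc_depth e a.
Proof.
move=> xa; rewrite -(arc_funE arc_depth_ends xa); apply/eqP.
rewrite eq_le; apply/andP; split; last first.
  set F := arc_fun _ _; have /(lipschitz_dist x (O Q)) : arc_lipschitz F.
    by apply: arc_fun_lipschitz => [|? ? ? _ _]; [exact: arc_depth_ends|exact: arc_depth_lipschitz].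
  by rewrite dist_sym -/(depth x) /F /= -/(O Q) depthO subr0.
rewrite (arc_funE arc_depth_ends xa) /arc_depth /rise /=.
have := at_pos_on_arc xa; rewrite /on_arc; case E: (far_end e) => [[v l]|] /andP[a0 al].
  rewrite le_min; apply/andP; split.
    by rewrite -lerBlDl; apply: le_trans (depth_dist _ _) _;
       apply: le_trans (dist_arc xa (at_tail e)) _; rewrite subr0 ger0_norm.
  by rewrite -addrA -lerBlDl; apply: le_trans (depth_dist _ _) _;
       apply: le_trans (dist_arc xa (at_far E)) _; rewrite distrC ger0_norm// subr_ge0.
by rewrite -lerBlDl; apply: le_trans (depth_dist _ _) _;
       apply: le_trans (dist_arc xa (at_tail e)) _; rewrite subr0 ger0_norm.
Qed.

End Distance.


(** * Rising halves of arcs *)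

Lemma lte_fin_Ny (R : realType) (t : R) : (t%:E < -oo)%E = false.
Proof. by []. Qed.

Section Halves.
Variables (R : realType) (Q : metric_graph R).
Hypothesis Qc : connected_graph Q.
Implicit Types (x y z : point Q) (e : arc Q) (h : arc Q * bool).

(** Along an arc the depth first rises at unit speed from the tail and then, on a
    bounded arc, falls at unit speed towards the far end; either part may be empty.
    [(e, false)] and [(e, true)] stand for the two open parts of [e], each traversed
    upwards, and [lo], [hi] bound their depths. *)
Definition lo h : R :=
  if h.2 then if far_end h.1 is Some (v, _) then depth (Vertex v) else 0
  else depth (Vertex (tail h.1)).

Definition hi h : \bar R :=
  if far_end h.1 is Some (v, l)
  then ((depth (Vertex (tail h.1)) + depth (Vertex v) + l%:num) / 2)%:E
  else if h.2 then -oo%E else +oo%E.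

Definition in_half h t : bool := (lo h < t) && (t%:E < hi h)%E.

Definition half_pos h t : R :=
  if h.2 then if far_end h.1 is Some (v, l) then depth (Vertex v) + l%:num - t else 0
  else t - depth (Vertex (tail h.1)).

Definition half_point h t : point Q :=
  if pselect (interior_pos h.1 (half_pos h t)) is left it then Inner it else O Q.

Lemma arc_ends e v (l : {posnum R}) : far_end e = Some (v, l) ->
  depth (Vertex v) <= depth (Vertex (tail e)) + l%:num /\
  depth (Vertex (tail e)) <= depth (Vertex v) + l%:num.
Proof.
move=> E; have [h1 h2] := arc_depth_ends Qc e; move/(_ _ _ E): h2 => h2.
have := arc_depth_lipschitz e 0 l%:num; have := arc_depth_lipschitz e l%:num 0.
by rewrite h1 h2 sub0r normrN subr0 ger0_norm//; lra.
Qed.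

Lemma in_half_interior h t : in_half h t -> interior_pos h.1 (half_pos h t).
Proof.
case: h => e b; rewrite /in_half /interior_pos /half_pos /lo /hi /=.
case E: (far_end e) => [[v l]|]; last by case: b; rewrite ?lte_fin_Ny ?andbF// subr_gt0 => /andP[->].
have [h1 h2] := arc_ends E; rewrite lte_fin.
by case: b => /andP[h3 h4]; apply/andP; split; lra.
Qed.

Lemma half_pointE h t (it : interior_pos h.1 (half_pos h t)) : half_point h t = Inner it.
Proof.
by rewrite /half_point; case: pselect => // it'; congr (Inner _); exact: bool_irrelevance.
Qed.

Lemma at_pos_half h t : in_half h t -> at_pos h.1 (half_pos h t) (half_point h t).
Proof. by move=> /in_half_interior it; rewrite (half_pointE it). Qed.

Lemma rise_half_pos h t : in_half h t -> rise h (half_pos h t) = t.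
Proof.
case: h => e [] ih; rewrite /rise /half_pos /=; last by rewrite addrC subrK.
move: ih; rewrite /in_half /lo /hi /=; case E: (far_end e) => [[v l]|] ih; first lra.
by move: ih; rewrite lte_fin_Ny andbF.
Qed.

Lemma half_pos_rise h t : (h.2 -> far_end h.1) -> half_pos h (rise h t) = t.
Proof.
case: h => e []; rewrite /rise /half_pos /=; last by move=> _; lra.
by case: (far_end e) => [[v l] _|/(_ erefl)//]; lra.
Qed.

Lemma arc_depth_rise h a : in_half h (rise h a) -> arc_depth h.1 a = rise h a.
Proof.
case: h => e b; rewrite /in_half /arc_depth /rise /lo /hi /=.
case E: (far_end e) => [[v l]|]; last by case: b => //; rewrite lte_fin_Ny andbF.
by rewrite lte_fin; case: b => /andP[h3 h4]; [apply/min_idPr|apply/min_idPl]; lra.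
Qed.

Lemma depth_half h t : in_half h t -> depth (half_point h t) = t.
Proof.
move=> ih; rewrite (depth_at Qc (at_pos_half ih)).
by rewrite arc_depth_rise rise_half_pos.
Qed.

Lemma lo_ge0 h : 0 <= lo h.
Proof.
by rewrite /lo; case: h.2; [case: far_end => [[v _]|]|]; rewrite ?lexx//; exact: depth_ge0.
Qed.

Lemma in_half_gt0 h t : in_half h t -> 0 < t.
Proof. by move=> /andP[+ _]; exact/le_lt_trans/lo_ge0. Qed.

Lemma in_half_convex h s t u : in_half h s -> in_half h u -> s <= t -> t <= u ->
  in_half h t.
Proof.
move=> /andP[s1 s2] /andP[u1 u2] st tu; apply/andP; split; first exact: lt_le_trans st.
by apply: le_lt_trans u2; rewrite lee_fin.
Qed.

Lemma half_point_inj h h' t t' : in_half h t -> in_half h' t' ->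
  half_point h t = half_point h' t' -> h = h' /\ t = t'.
Proof.
move=> ih ih' E; have tt' : t = t' by rewrite -(depth_half ih) E depth_half.
split=> //; rewrite -{t'}tt' in ih' E.
move: E; rewrite (half_pointE (in_half_interior ih)) (half_pointE (in_half_interior ih')).
move=> [ee pp]; move: ih ih' ee pp.
case: h h' => [e b] [e' b']; rewrite /in_half /half_pos /lo /hi /= => ih ih' ee.
move: ih ih'; rewrite {}ee; case: b b' => [] [] //; case: (far_end e') => [[v l]|].
- by rewrite lte_fin => /andP[] ? ? /andP[] ? ? ?; exfalso; lra.
- by rewrite lte_fin_Ny andbF.
- by rewrite lte_fin => /andP[] ? ? /andP[] ? ? ?; exfalso; lra.
- by rewrite lte_fin_Ny andbF.
Qed.

(** A walk that leaves a half from a point [c] inside it has length at least [c]. *)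
Lemma half_points_far h h' t t' c : 0 < c -> in_half h (t - c) -> in_half h (t + c) ->
  in_half h' (t' - c) -> in_half h' (t' + c) -> h <> h' ->
  c <= dist (half_point h t) (half_point h' t').
Proof.
move=> c0 i1 i2 i1' i2' hh'.
have ih : in_half h t by apply: (in_half_convex i1 i2); lra.
have ih' : in_half h' t' by apply: (in_half_convex i1' i2'); lra.
have L : arc_lipschitz (bump h.1 (half_pos h t) c).
  have o1 := at_pos_on_arc (at_pos_half i1); have o2 := at_pos_on_arc (at_pos_half i2).
  suff H : (half_pos h t - c = half_pos h (t - c) /\ half_pos h t + c = half_pos h (t + c))
        \/ (half_pos h t - c = half_pos h (t + c) /\ half_pos h t + c = half_pos h (t - c)).
    by case: H => -[E1 E2]; apply: bump_lipschitz; rewrite ?E1 ?E2 ?ltW.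
  move: ih; rewrite /half_pos /in_half /hi; case: (h.2); last by left; split; lra.
  case: (far_end h.1) => [[v l]|] ih; first by right; split; lra.
  by move: ih; rewrite lte_fin_Ny andbF.
apply: le_trans (lipschitz_dist Qc _ _ L); rewrite /bump.
rewrite (half_pointE (in_half_interior ih)) (half_pointE (in_half_interior ih')) /=.
rewrite asboolT// subrr normr0 subr0 (max_idPr (ltW c0)).
case: asboolP => [ee|]; last by rewrite subr0.
suff /max_idPl -> : c - `|half_pos h' t' - half_pos h t| <= 0 by rewrite subr0.
rewrite subr_le0; move: i1 i2 i1' i2' ee hh' {ih ih' L}.
case: h h' => [e b] [e' b']; rewrite /in_half /half_pos /lo /hi /= => + + + + ee.
rewrite {}ee; case: b b' => [] [] //; case: (far_end e) => [[v l]|]; rewrite ?lte_fin.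
- move=> /andP[? ?] /andP[? ?] /andP[? ?] /andP[? ?] _.
  have := ler_norm (- (t' - depth (Vertex (tail e)) - (depth (Vertex v) + l%:num - t))).
  by rewrite normrN; lra.
- by rewrite lte_fin_Ny andbF.
- move=> /andP[? ?] /andP[? ?] /andP[? ?] /andP[? ?] _.
  by have := ler_norm (depth (Vertex v) + l%:num - t' - (t - depth (Vertex (tail e)))); lra.
- by rewrite lte_fin_Ny !andbF.
Qed.

End Halves.


(** * Uniqueness of shortest paths below a half *)

Section Enter.
Variables (R : realType) (Q : metric_graph R).
Hypothesis Qc : connected_graph Q.
Implicit Types (x y z : point Q) (e : arc Q) (h : arc Q * bool).

Lemma min_lipschitz (a b a' b' d : R) : a - a' <= d -> b - b' <= d ->
  Num.min a b - Num.min a' b' <= d.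
Proof. by case: (leP a b) => ?; case: (leP a' b') => ?; lra. Qed.

Lemma max_lipschitz (a b a' b' d : R) : a - a' <= d -> b - b' <= d ->
  Num.max a b - Num.max a' b' <= d.
Proof. by case: (leP a b) => ?; case: (leP a' b') => ?; lra. Qed.

Lemma rise_lipschitz h a b : rise h a - rise h b <= `|a - b|.
Proof.
have h1 := ler_norm (a - b); have := ler_norm (b - a); rewrite distrC => h2.
rewrite /rise; case: h.2; last by lra.
by case: (far_end h.1) => [[v l]|]; lra.
Qed.

(** A shortest path to a point inside a half runs up that half at the end.  To see
    it, cap the depth at a level [s] everywhere except on the segment of the half
    between [s] and a level [b], on which the depth still rises above [s] and
    then returns to it; the result is still 1-Lipschitz, so a point of depth more than
    [s] outside the segment is too far away. *)
Lemma half_enter h t : in_half h t -> exists s, [/\ 0 <= s, s < t &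
  forall y, s < depth y -> dist y (half_point h t) <= t - depth y ->
    y = half_point h (depth y)].
Proof.
move=> ih; have /andP[t1 t2] := ih.
have [b tb bhi] : exists2 b, t < b & (b%:E <= hi h)%E.
  case: (hi h) t2 => [r| |] //; last by exists (t + 1); rewrite ?ltrDl// leey.
  by rewrite lte_fin => tr; exists r.
pose s := Num.max ((lo h + t) / 2) (2 * t - b).
have los : lo h < s by rewrite /s lt_max; apply/orP; left; lra.
have st : s < t by rewrite /s gt_max; apply/andP; split; lra.
have bs : 2 * t - b <= s by rewrite /s le_max lexx orbT.
exists s; split=> //; first by apply: ltW (le_lt_trans _ los); exact: lo_ge0.
pose seg a := Num.min (arc_depth h.1 a) (Num.max s (Num.min (rise h a) (s + b - rise h a))).
pose fe e a := if `[< e = h.1 >] then seg a else Num.min (arc_depth e a) s.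
pose F := arc_fun (fun v => Num.min (depth (Vertex v)) s) fe.
have FL : arc_lipschitz F.
  apply: arc_fun_lipschitz => [e|e a c _ _]; last first.
    have hd := arc_depth_lipschitz e a c; have n0 := normr_ge0 (a - c).
    rewrite /fe; case: asboolP hd => [->|_] hd; last by apply: min_lipschitz; rewrite ?subrr.
    apply: min_lipschitz => //; apply: max_lipschitz; first by rewrite subrr.
    apply: min_lipschitz; first exact: rise_lipschitz.
    by have := rise_lipschitz h c a; rewrite distrC; lra.
  have [m0 ml] := arc_depth_ends Qc e.
  rewrite /fe; case: asboolP => [ee|_]; last first.
    by rewrite m0; split=> // v l /ml ->.
  rewrite /seg; split=> [|v l E].
    rewrite -ee m0; move: los bhi; rewrite /lo /hi /rise -ee.
    case: (h.2) => los bhi; last first.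
      rewrite addr0 (min_idPl (_ : _ <= s)); last exact: ltW.
      by apply/min_idPl; rewrite le_max (ltW los).
    congr Num.min; apply/max_idPl; rewrite ge_min.
    move: los bhi; case E: (far_end e) => [[v l]|]; last by rewrite leeNy_eq.
    by have [? ?] := arc_ends Qc E; rewrite lee_fin => ? ?; apply/orP; right; lra.
  rewrite -ee (ml _ _ E); move: los bhi; rewrite /lo /hi /rise -ee E.
  have [? ?] := arc_ends Qc E; rewrite lee_fin; case: (h.2) => los bhi.
    rewrite addrK (min_idPl (_ : _ <= s)); last exact: ltW.
    by apply/min_idPl; rewrite le_max (ltW los).
  congr Num.min; apply/max_idPl; rewrite ge_min; apply/orP; right; lra.
move=> y sy dy; have := lipschitz_dist Qc (half_point h t) y FL.
have -> : F (half_point h t) = t.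
  rewrite /F (half_pointE (in_half_interior Qc ih)) /= /fe asboolT// /seg.
  rewrite rise_half_pos// arc_depth_rise ?rise_half_pos//.
  rewrite [X in Num.max _ X](min_idPl _); last by lra.
  by rewrite (max_idPr (ltW st)) minxx.
rewrite dist_sym// => hF; have {hF dy} : depth y <= F y by lra.
case: y sy => [v|e a ia] sy; rewrite /F /=.
  by rewrite le_min => /andP[_]; rewrite leNgt sy.
rewrite /fe; case: asboolP => [ee|_]; last first.
  by rewrite le_min => /andP[_]; rewrite leNgt sy.
rewrite /seg le_min le_max [(_ <= s)]leNgt sy /= => /andP[_].
rewrite le_min => /andP[r1 r2].
have ir : in_half h (rise h a).
  apply/andP; split; first lra.
  by apply: lt_le_trans bhi; rewrite lte_fin; lra.
have dE : depth (@Inner _ _ e a ia) = rise h a.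
  by rewrite (depth_at Qc (conj erefl erefl : at_pos e a (Inner ia))) ee arc_depth_rise.
rewrite dE; have pa : half_pos h (rise h a) = a.
  apply: half_pos_rise => h2; move: ih; rewrite /in_half /hi h2.
  by case: (far_end h.1) => //; rewrite lte_fin_Ny andbF.
move: ia {sy dE r1 r2}; rewrite ee => ia.
have ia' := in_half_interior Qc ir; rewrite (half_pointE ia').
by move: ia'; rewrite pa => ia'; congr (Inner _); exact: bool_irrelevance.
Qed.

End Enter.

(** * Consequences of the bound on the level sets *)

Section Levels.
Variables (R : realType) (Q : metric_graph R) (N : nat).
Hypothesis Qc : connected_graph Q.
Hypothesis Qn : levels_bounded_by Q N.
Implicit Types (x y z : point Q) (e : arc Q) (h : arc Q * bool).

Definition half_nonempty h := exists t, in_half h t.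

Definition half_ends : set R :=
  [set t | exists2 h, half_nonempty h & t = lo h \/ t = fine (hi h)].

(** Each nonempty half contains a point of rational depth, and at each positive depth
    there are finitely many points; hence there are countably many halves. *)
Lemma half_code : exists code : arc Q * bool -> nat,
  forall h h', half_nonempty h -> half_nonempty h' -> code h = code h' -> h = h'.
Proof.
pose B := \bigcup_(q in [set q : rat | 0 < ratr q :> R]) [set x : point Q | depth x = ratr q].
have cB : countable B.
  apply: bigcup_countable => // q /= q0.
  by apply/finite_set_countable/(card_le_finite (Qn q0)); exact: finite_II.
have /countable_injP[f finj] := cB.
have rat_in h : half_nonempty h -> exists q : rat, in_half h (ratr q).
  case=> t /andP[t1 t2].
  have [b tb bhi] : exists2 b, t < b & (b%:E <= hi h)%E.
    case: (hi h) t2 => [r| |] //; last by exists (t + 1); rewrite ?ltrDl// leey.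
    by rewrite lte_fin => tr; exists r.
  have [q] := rat_in_itvoo tb; rewrite in_itv /= => /andP[q1 q2].
  exists q; apply/andP; split; first exact: lt_trans q1.
  by apply: lt_le_trans bhi; rewrite lte_fin.
have /choice[q qP] : forall h, exists q : rat, half_nonempty h -> in_half h (ratr q).
  by move=> h; have [/rat_in[q ?]|] := pselect (half_nonempty h); [exists q|exists 0].
exists (fun h => f (half_point h (ratr (q h)))) => h h' /qP ih /qP ih' /finj E.
have inB h0 : in_half h0 (ratr (q h0)) -> half_point h0 (ratr (q h0)) \in B.
  move=> i; rewrite inE; exists (q h0) => /=; first exact: in_half_gt0 Qc _ _ i.
  exact: depth_half.
by have [] := half_point_inj Qc ih ih' (E (inB _ ih) (inB _ ih')).
Qed.

Lemma half_ends_countable : countable half_ends.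
Proof.
have [code codeI] := half_code.
have cN : countable [set h : arc Q * bool | half_nonempty h].
  by apply/countable_injP; exists code => h h'; rewrite !inE => ? ?; exact: codeI.
have -> : half_ends = \bigcup_(b in [set: bool])
    ((fun h => if b then lo h else fine (hi h)) @` [set h | half_nonempty h]).
  apply/seteqP; split=> [t [h hn [->|->]]|t [b _ [h hn <-]]].
  - by exists true => //; exists h.
  - by exists false => //; exists h.
  - by exists h => //; case: b; [left|right].
apply: bigcup_countable => [|b _]; first exact: countableP.
by apply: sub_countable cN; exact: card_image_le.
Qed.

Lemma depth_lo_or_hi e : (half_nonempty (e, false) /\ lo (e, false) = depth (Vertex (tail e)))
  \/ (half_nonempty (e, true) /\ hi (e, true) = (depth (Vertex (tail e)))%:E).
Proof.
rewrite /half_nonempty /in_half /lo /hi /=; set d := depth _.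
case E: (far_end e) => [[v l]|]; last first.
  by left; split=> //; exists (d + 1); rewrite ltrDl ltry ltr01.
have [h1 h2] := arc_ends Qc E; have l0 := posnumP l; rewrite -/d in h1 h2.
have [?|?] := ltP d (depth (Vertex v) + l%:num).
  by left; split=> //; exists ((3 * d + depth (Vertex v) + l%:num) / 4); rewrite lte_fin; apply/andP; split; lra.
right; split; last by congr (_%:E); lra.
by exists ((depth (Vertex v) + d) / 2); rewrite lte_fin; apply/andP; split; lra.
Qed.

Lemma depth_far_lo_or_hi e v (l : {posnum R}) : far_end e = Some (v, l) ->
  (half_nonempty (e, true) /\ lo (e, true) = depth (Vertex v))
  \/ (half_nonempty (e, false) /\ hi (e, false) = (depth (Vertex v))%:E).
Proof.
rewrite /half_nonempty /in_half /lo /hi /=; set d := depth (Vertex v) => E; rewrite E.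
have [h1 h2] := arc_ends Qc E; have l0 := posnumP l; rewrite -/d in h1 h2.
have [?|?] := ltP d (depth (Vertex (tail e)) + l%:num).
  by left; split=> //; exists ((3 * d + depth (Vertex (tail e)) + l%:num) / 4); rewrite lte_fin; apply/andP; split; lra.
right; split; last by congr (_%:E); lra.
by exists ((depth (Vertex (tail e)) + d) / 2); rewrite lte_fin; apply/andP; split; lra.
Qed.

Lemma vertex_half_ends e a v : at_pos e a (Vertex v) -> half_ends (depth (Vertex v)).
Proof.
case=> [[_ <-]|[l /depth_far_lo_or_hi E _]].
  by case: (depth_lo_or_hi e) => -[? E]; [exists (e, false)|exists (e, true)];
    rewrite // E; [left|right].
by case: E => -[? E]; [exists (e, true)|exists (e, false)]; rewrite // E; [left|right].
Qed.

Lemma walk_first x y l : walk x y l -> x = y \/ exists e a, at_pos e a x.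
Proof. by case=> [z|e a b x1 y1 z k pa _ _]; [left|right; exists e, a]. Qed.

(** The points outside halves are the vertices and the peaks of the arcs; their depths
    are ends of halves, since the depth is strictly monotone near either end
    of each half of an arc. *)
Lemma depth_in_half x : 0 < depth x -> ~ half_ends (depth x) ->
  exists2 h, in_half h (depth x) & x = half_point h (depth x).
Proof.
move=> x0 nx; case: x x0 nx => [v|e a ia] x0 nx.
  exfalso; apply: nx; have [l w] := Qc (Vertex v) (O Q).
  case: (walk_first w) => [E|[e [a /vertex_half_ends//]]].
  by move: x0; rewrite E (depthO Qc) ltxx.
have pa : at_pos e a (Inner ia) by [].
have dE := depth_at Qc pa.
suff [h [he ih rh]] : exists h, [/\ h.1 = e, in_half h (depth (Inner ia)) &
    half_pos h (depth (Inner ia)) = a].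
  exists h => //; have i := in_half_interior Qc ih.
  rewrite (half_pointE i); move: i; rewrite rh he => i.
  by congr (Inner _); exact: bool_irrelevance.
case/andP: (ia) => a0 al.
move: dE al nx; rewrite /arc_depth /rise /=; case E: (far_end e) => [[v l]|]; last first.
  move=> -> _ _; exists (e, false); split=> //; rewrite /in_half /half_pos /lo /hi /= ?E.
    by rewrite ltrDl a0 ltry.
  by rewrite addrC addKr.
have [h1 h2] := arc_ends Qc E.
case: (ltgtP (depth (Vertex (tail e)) + a)) => [lt|lt|eq] -> al nx.
- exists (e, false); split=> //; rewrite /in_half /half_pos /lo /hi /= ?E ?lte_fin; last lra.
  by apply/andP; split; lra.
- exists (e, true); split=> //; rewrite /in_half /half_pos /lo /hi /= ?E ?lte_fin; last lra.
  by apply/andP; split; lra.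
exfalso; apply: nx; exists (e, false).
  exists (depth (Vertex (tail e)) + a / 2).
  by rewrite /in_half /lo /hi /= E lte_fin; apply/andP; split; lra.
by right; rewrite /hi /= E /=; lra.
Qed.

Lemma level_pigeonhole (h : nat -> arc Q * bool) t : injective h ->
  (forall n, (n <= N)%N -> in_half (h n) t) -> False.
Proof.
move=> hI ht; have t0 := in_half_gt0 Qc (ht 0%N (leq0n _)).
have := Qn t0; suff /card_le_trans /[apply] : `I_N.+1 #<= [set x : point Q | depth x = t].
  by rewrite card_le_II ltnn.
have xI : {in `I_N.+1 &, injective (fun n => half_point (h n) t)}.
  move=> n m; rewrite !inE => nN mN E; apply: hI.
  by have [] := half_point_inj Qc (ht n nN) (ht m mN) E.
have sub : [set half_point (h n) t | n in `I_N.+1] `<=` [set x : point Q | depth x = t].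
  by move=> _ [n /= nN <-]; exact/depth_half/ht.
apply: card_le_trans (subset_card_le sub).
by have := inj_card_eq xI; rewrite card_eq_le => /andP[].
Qed.

(** Halves of width tending to 0 that all reach a common level would provide
    infinitely many distinct halves, any finite number of which share a level. *)
Lemma shrinking_halves_false (C : arc Q * bool -> Prop) (W : arc Q * bool -> R) :
  (forall c, 0 < c -> exists h, [/\ C h, 0 < W h & W h <= c]) ->
  (forall w, 0 < w -> exists t, forall h, C h -> w <= W h -> in_half h t) -> False.
Proof.
move=> small level; have /choice[f fP] : forall c : R, exists h,
    0 < c -> [/\ C h, 0 < W h & W h <= c].
  move=> c; have [/small[h ?]|c0] := ltP 0 c; first by exists h.
  by have [h _] := small 1 ltr01; exists h.
pose h := fix h n := if n is k.+1 then f (W (h k) / 2) else f 1.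
have hP n : C (h n) /\ 0 < W (h n).
  by elim: n => [|n [_ W0]] /=; [have [] := fP 1 ltr01|
    have [] := fP (W (h n) / 2) (divr_gt0 W0 (ltr0Sn _ _))].
have dec n : W (h n.+1) < W (h n).
  have [_ W0] := hP n; have [_ _] := fP _ (divr_gt0 W0 (ltr0Sn _ 1)).
  by rewrite -/(h n.+1); lra.
have mono n m : (n <= m)%N -> W (h m) <= W (h n).
  elim: m => [|m IH]; first by rewrite leqn0 => /eqP ->.
  by rewrite leq_eqVlt => /predU1P[->//|/IH]; apply/le_trans/ltW/dec.
have [t tP] := level _ (hP N).2.
apply: (@level_pigeonhole h t) => [n m E|n nN]; last by apply: tP (mono _ _ nN); case: (hP n).
apply/eqP; case: ltngtP => // lt.
  by have := mono _ _ lt; rewrite leNgt -E dec.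
by have := mono _ _ lt; rewrite leNgt E dec.
Qed.

Lemma inner_dist0 e t (it : interior_pos e t) y : dist (Inner it) y = 0 -> y = Inner it.
Proof.
move=> d0; have /andP[t0 tl] := it.
pose c := if far_end e is Some (_, l) then Num.min t (l%:num - t) else t.
have c0 : 0 < c.
  by rewrite /c; move: tl; case: (far_end e) => [[v l]|] // tl; rewrite lt_min t0 subr_gt0.
have L : arc_lipschitz (bump e t c).
  apply: bump_lipschitz; first exact: ltW.
    rewrite /on_arc /c; move: tl; case: (far_end e) => [[v l]|] tl; last by rewrite subrr lexx.
    by case: (leP t (l%:num - t)) => ?; apply/andP; split; lra.
  rewrite /on_arc /c; move: tl; case: (far_end e) => [[v l]|] tl; last by rewrite andbT; lra.
  by case: (leP t (l%:num - t)) => ?; apply/andP; split; lra.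
have := lipschitz_dist Qc (Inner it) y L; rewrite d0 /bump /=.
rewrite asboolT// subrr normr0 subr0 (max_idPr (ltW c0)).
case: y {d0} => [v|e' t' it'] /=; first by rewrite subr0 leNgt c0.
case: asboolP => [ee|_]; last by rewrite subr0 leNgt c0.
move=> le; have tt : t' = t.
  apply/eqP; rewrite -subr_eq0 -normr_le0; move: le.
  by case: (leP 0 (c - `|t' - t|)) => ? ?; lra.
by move: it'; rewrite ee tt => it'; congr (Inner _); exact: bool_irrelevance.
Qed.

(** Distinct vertices at distance 0 would require arbitrarily short arcs at a
    vertex, hence more than [N] halves over a common level near it. *)
Lemma dist0_eq x y : dist x y = 0 -> x = y.
Proof.
case: x => [u|e t it]; last by move/inner_dist0.
case: y => [v|e t it]; last by rewrite dist_sym// => /inner_dist0.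
move=> d0; apply: contrapT => uv.
pose at_u e := exists a, at_pos e a (@Vertex R Q u).
have short c : 0 < c -> exists e v' (l : {posnum R}),
    [/\ at_u e, far_end e = Some (v', l) & l%:num < c].
  move=> c0; apply: contrapT => H.
  (* If all arcs at [u] have length at least [c], the excess of [c] over the distance
     to [u] along an arc is 1-Lipschitz, and separates [u] from [v]. *)
  have long e v' (l : {posnum R}) : at_u e -> far_end e = Some (v', l) -> c <= l%:num.
    by move=> eu E; rewrite leNgt; apply/negP => lc; apply: H; exists e, v', l.
  pose ft e t := if `[< tail e = u >] then Num.max 0 (c - t) else 0.
  pose ff e t := if far_end e is Some (v, l) then
      if `[< v = u >] then Num.max 0 (c - (l%:num - t)) else 0 else 0.
  pose F := arc_fun (fun v => if `[< v = u >] then c else 0) (fun e t => Num.max (ft e t) (ff e t)).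
  have FL : arc_lipschitz F.
    apply: arc_fun_lipschitz => [e|e a b _ _].
      rewrite /ft /ff; split.
        case: asboolP => [tu|tu].
          have eu : at_u e by exists 0; left.
          rewrite subr0 (max_idPr (ltW c0)); apply/max_idPl.
          case E: (far_end e) => [[w l]|]; last exact: ltW.
          case: asboolP => _; last exact: ltW.
          by rewrite ge_max (ltW c0) subr0 lerBlDr lerDl ge0.
        apply/max_idPl; case E: (far_end e) => [[w l]|] //; case: asboolP => // wu.
        have eu : at_u e by exists l%:num; right; exists l => //; rewrite E wu.
        by rewrite ge_max lexx subr0 subr_le0 (long _ _ _ eu E).
      move=> w l E; rewrite E subrr subr0 (max_idPr (ltW c0)).
      case: (asboolP (w = u)) => wu.
        have eu : at_u e by exists l%:num; right; exists l => //; rewrite E wu.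
        apply/max_idPr; case: asboolP => _; last exact: ltW.
        by rewrite ge_max (ltW c0) lerBlDr lerDl ge0.
      apply/max_idPr; case: asboolP => // tu.
      have eu : at_u e by exists 0; left.
      by rewrite ge_max lexx subr_le0 (long _ _ _ eu E).
    have n1 := ler_norm (a - b); have := ler_norm (b - a); rewrite distrC => n2.
    have n0 := normr_ge0 (a - b); apply: max_lipschitz.
      rewrite /ft; case: asboolP => _; last by rewrite subrr.
      by apply: max_lipschitz; [rewrite subrr|lra].
    rewrite /ff; case: (far_end e) => [[w l]|]; last by rewrite subrr.
    case: asboolP => _; last by rewrite subrr.
    by apply: max_lipschitz; [rewrite subrr|lra].
  have := lipschitz_dist Qc (Vertex u) (Vertex v) FL; rewrite d0 /F /= asboolT// asboolF.
    by rewrite subr0 leNgt c0.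
  by move=> vu; apply: uv; rewrite vu.
set d := depth (@Vertex R Q u).
pose W h := if `[< lo h = d >] then fine (hi h) - d else d - lo h.
pose up h := lo h = d; pose down h := hi h = d%:E /\ lo h < d.
have side c : 0 < c -> exists h, (up h \/ down h) /\ 0 < W h /\ W h <= c.
  move=> /short[e [w [l [[a eu] E lc]]]]; have [h1 h2] := arc_ends Qc E.
  have [h [he ne ud]] : exists h, [/\ h.1 = e, half_nonempty h & lo h = d \/ hi h = d%:E].
    case: eu => [[_ tu]|[l' E' _]].
      have := depth_lo_or_hi e; rewrite tu -/d => -[[? ?]|[? ?]].
        by exists (e, false); split=> //; left.
      by exists (e, true); split=> //; right.
    have := depth_far_lo_or_hi E'; rewrite -/d => -[[? ?]|[? ?]].
      by exists (e, true); split=> //; left.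
    by exists (e, false); split=> //; right.
  exists h; have [b hb] : exists b, hi h = b%:E by rewrite /hi he E; eexists.
  case: ne => t; rewrite /in_half hb lte_fin => /andP[t1 t2].
  have bl : b - lo h <= l%:num.
    by move: hb; rewrite /hi /lo he E => -[<-]; case: (h.2); lra.
  rewrite /W /up /down; case: asboolP => [ld|ld]; first by rewrite hb /=; split; [left|split; lra].
  case: ud => // hd; move: hd; rewrite hb => -[bd]; rewrite -bd.
  by split; [right; split=> //; lra|split; lra].
have [all_up|/existsNP[c /not_implyP[c0 no_up]]] :=
    pselect (forall c, 0 < c -> exists h, [/\ up h, 0 < W h & W h <= c]).
  apply: shrinking_halves_false all_up _ => w w0; exists (d + w / 2) => h; rewrite /W /in_half => ld.
  rewrite asboolT// ld => wh; apply/andP; split; first lra.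
  case: (hi h) wh => [b| |] /= wh; [by rewrite lte_fin; lra|exact: ltry|exfalso].
  by have := depth_ge0 Qc (Vertex u); rewrite -/d; lra.
apply: (@shrinking_halves_false down W) => [c' c'0|w w0].
  have [h [[hu|hd] [W0 Wc]]] : exists h, (up h \/ down h) /\ 0 < W h /\ W h <= Num.min c c'.
  - by apply: side; rewrite lt_min c0.
  - by exfalso; apply: no_up; exists h; split=> //; apply: le_trans Wc _; rewrite ge_min lexx.
  - by exists h; split=> //; apply: le_trans Wc _; rewrite ge_min lexx orbT.
exists (d - w / 2) => h [hd ld]; rewrite /W asboolF => [wh|]; last lra.
by rewrite /in_half hd lte_fin; apply/andP; split; lra.
Qed.

End Levels.


(** * Shortest paths and their prefixes *)

Section Paths.
Variables (R : realType) (Q : metric_graph R) (N : nat).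
Hypothesis Qc : connected_graph Q.
Hypothesis Qn : levels_bounded_by Q N.
Implicit Types (x y z : point Q) (p q : spath Q) (t u v : R).

Lemma spath_eq p q : plen p = plen q -> agree_on p q 0 (plen p) -> p = q.
Proof.
case: p q => [l f l0 f0 fd fo] [l' g l'0 g0 gd go] /= E; case: l' / E l'0 gd go => l'0 gd go ag.
have fg : f = g.
  apply/funext => t; have [t0|t0] := ltP t 0; first by rewrite fo ?go//; left.
  by have [tl|tl] := leP t l; [apply: ag; rewrite t0|rewrite fo ?go//; right].
case: g / fg g0 gd go {ag} => g0 gd go.
by congr SPath; exact: Prop_irrelevance.
Qed.

Lemma pfun_depth p t : 0 <= t -> t <= plen p -> depth (p t) = t.
Proof. by move=> t0 tp; rewrite /depth -{1}(pfun0 p) pfun_dist// subr0. Qed.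

Lemma depth_pend p : depth (pend p) = plen p.
Proof. by rewrite pfun_depth// plen_ge0. Qed.

Let clip p t := Num.max 0 (Num.min t (plen p)).

Let clip_le p t : 0 <= clip p t <= plen p.
Proof. by rewrite /clip le_max lexx ge_max plen_ge0 ge_min lexx orbT. Qed.

Let trunc_fun p t (a : R) := if (0 <= a) && (a <= clip p t) then p a else O Q.

Let trunc_ge0 p t : 0 <= clip p t. Proof. by case/andP: (clip_le p t). Qed.

Let trunc0 p t : trunc_fun p t 0 = O Q.
Proof. by rewrite /trunc_fun lexx trunc_ge0 pfun0. Qed.

Let trunc_dist p t a b : 0 <= a -> a <= b -> b <= clip p t ->
  dist (trunc_fun p t a) (trunc_fun p t b) = b - a.
Proof.
move=> a0 ab bt; rewrite /trunc_fun a0 bt (le_trans ab bt) (le_trans a0 ab) /=.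
by apply: pfun_dist => //; case/andP: (clip_le p t) => _; exact: le_trans.
Qed.

Let trunc_out p t a : a < 0 \/ clip p t < a -> trunc_fun p t a = O Q.
Proof.
by rewrite /trunc_fun => -[a0|a1]; [rewrite leNgt a0|rewrite [X in _ && X]leNgt a1 andbF].
Qed.

Definition trunc p t : spath Q :=
  SPath (trunc_ge0 p t) (trunc0 p t) (@trunc_dist p t) (@trunc_out p t).

Lemma plen_trunc p t : 0 <= t -> t <= plen p -> plen (trunc p t) = t.
Proof. by move=> t0 tp; rewrite /= /clip (min_idPl tp) (max_idPr t0). Qed.

Lemma trunc_agree p t : 0 <= t -> t <= plen p -> agree_on (trunc p t) p 0 t.
Proof. by move=> t0 tp a a0t; rewrite /= /trunc_fun /clip (min_idPl tp) (max_idPr t0) a0t. Qed.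

Lemma trunc_prefix p t : 0 <= t -> t <= plen p -> prefix_of (trunc p t) p.
Proof. by move=> t0 tp; rewrite /prefix_of plen_trunc//; split=> //; exact: trunc_agree. Qed.

Lemma agree_on_sym p q a b : agree_on p q a b -> agree_on q p a b.
Proof. by move=> ag t /ag. Qed.

Lemma agree_on_trans q p r a b : agree_on p q a b -> agree_on q r a b -> agree_on p r a b.
Proof. by move=> pq qr t tab; rewrite pq ?qr. Qed.

Lemma agree_on_le p q t u : u <= t -> agree_on p q 0 t -> agree_on p q 0 u.
Proof. by move=> ut ag a /andP[a0 au]; apply: ag; rewrite a0 (le_trans au). Qed.

Lemma prefix_refl p : prefix_of p p.
Proof. by split. Qed.

Lemma prefix_trans q p r : prefix_of p q -> prefix_of q r -> prefix_of p r.
Proof.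
move=> [pq apq] [qr aqr]; split; first exact: le_trans qr.
by apply: agree_on_trans apq _; exact: agree_on_le aqr.
Qed.

Lemma prefix_eq p q : prefix_of p q -> plen p = plen q -> p = q.
Proof. by move=> [_ ag] E; exact: spath_eq. Qed.

Lemma prefix_common p q r : prefix_of p r -> prefix_of q r -> plen p <= plen q ->
  prefix_of p q.
Proof.
move=> [pr apr] [qr aqr] pq; split=> //; apply: agree_on_trans apr _.
by apply: agree_on_sym; exact: agree_on_le aqr.
Qed.

Lemma tree_distC p q : tree_dist p q = tree_dist q p.
Proof.
rewrite /tree_dist (addrC (plen p)); congr (_ - _ *+ 2); congr sup; apply/seteqP.
by split=> u /= [u0 up uq ag]; split=> //; exact: agree_on_sym.
Qed.

Let meets p q := [set u | [/\ 0 <= u, u <= plen p, u <= plen q & agree_on p q 0 u]].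

Let meets0 p q : meets p q 0.
Proof.
split; rewrite ?plen_ge0// => t /andP[t0 t0'].
by rewrite (le_anti (_ : t <= 0 <= t)) ?t0 ?t0'// !pfun0.
Qed.

Let meets_ub p q : has_ubound (meets p q).
Proof. by exists (plen p) => u []. Qed.

Lemma meet_ge0 p q : 0 <= meet_depth p q.
Proof. by apply: ub_le_sup => //; [exact: meets_ub|exact: meets0]. Qed.

Lemma meet_le_plen p q : meet_depth p q <= plen p /\ meet_depth p q <= plen q.
Proof. by split; apply: ge_sup; try (by exists 0; exact: meets0); move=> u []. Qed.

Lemma le_meet p q u : 0 <= u -> u <= plen p -> u <= plen q -> agree_on p q 0 u ->
  u <= meet_depth p q.
Proof. by move=> *; apply: ub_le_sup => //; exact: meets_ub. Qed.

Lemma meet_agree p q u : u < meet_depth p q -> agree_on p q 0 u.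
Proof.
move=> /sup_gt[]; first by exists 0; exact: meets0.
by move=> v [v0 vp vq ag] uv; apply: agree_on_le ag; exact: ltW.
Qed.

(** By continuity the end points are at distance 0, hence equal. *)
Lemma agree_on_closed p q t : 0 < t -> t <= plen p -> t <= plen q ->
  (forall u, 0 <= u -> u < t -> agree_on p q 0 u) -> agree_on p q 0 t.
Proof.
move=> t0 tp tq ag u /andP[u0]; rewrite le_eqVlt => /predU1P[->|ut]; last first.
  by apply: (ag u) => //; rewrite u0 lexx.
apply: (dist0_eq Qc Qn); apply/eqP; rewrite eq_le dist_ge0// andbT.
apply/ler_addgt0Pr => e e0; rewrite add0r.
pose a := Num.max 0 (t - e / 2).
have a0 : 0 <= a by rewrite le_max lexx.
have at_ : a < t by rewrite gt_max t0; lra.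
have ae : t - a <= e / 2 by rewrite /a; case: (leP 0 (t - e / 2)) => ?; lra.
apply: le_trans (dist_triangle Qc (p a) _ _) _.
rewrite {2}(ag a a0 at_ a) ?a0 ?lexx// dist_sym// !pfun_dist//; try lra; exact: ltW.
Qed.

Lemma tree_dist_plen p q : 0 <= plen q - meet_depth p q <= tree_dist p q.
Proof.
have [h1 h2] := meet_le_plen p q; rewrite /tree_dist mulr2n.
by apply/andP; split; lra.
Qed.

Section Tree.
Variable G : set (spath Q).
Hypothesis Gt : shortest_path_tree G.

(** At a level that bounds no half, the projection of the tree to the network is
    injective: two paths with the same end would share the last segment below
    it, which the cutting forbids. *)
Lemma pend_inj p q : G p -> G q -> plen p = plen q -> ~ half_ends Q (plen p) ->
  pend p = pend q -> p = q.
Proof.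
move=> Gp Gq pq np E.
have [p0|p0] := ltP 0 (plen p); last first.
  have {}p0 : plen p = 0 by apply/le_anti; rewrite p0 plen_ge0.
  by apply: spath_eq => // t; rewrite p0 => /le_anti <-; rewrite !pfun0.
have [h] : exists2 h, in_half h (depth (pend p)) & pend p = half_point h (depth (pend p)).
  by apply: (depth_in_half Qc); rewrite depth_pend.
rewrite depth_pend => ih xh.
have [s [s0 st sP]] := half_enter Qc ih.
have on_half r : plen r = plen p -> pend r = pend p ->
    forall t, s < t -> t <= plen p -> r t = half_point h t.
  move=> rp re t ts tp; have t0 : 0 <= t by lra.
  have := sP (r t); rewrite pfun_depth ?rp//; apply=> //.
  by rewrite -xh -re /pend pfun_dist ?rp.
pose s' := (s + plen p) / 2.
have ag : agree_on p q s' (plen p).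
  by move=> t /andP[t1 t2]; rewrite !on_half//; rewrite /s' in t1; lra.
have [s'0 s'p] : 0 <= s' /\ s' < plen p by rewrite /s'; split; lra.
have pq' : plen p <= plen q by rewrite pq.
have ag0 := spt_cut Gt Gp Gq s'0 s'p (lexx _) pq' ag.
apply: spath_eq => // t /andP[t0 tp].
by have [ts|ts] := leP t s'; [apply: ag0; rewrite t0|apply: ag; rewrite ltW].
Qed.

End Tree.
End Paths.


(** * Depth-first tours *)

Section Tours.
Variables (R : realType) (Q : metric_graph R) (N : nat).
Hypothesis Qc : connected_graph Q.
Hypothesis Qn : levels_bounded_by Q N.
Implicit Types (x y z : point Q) (p q : spath Q) (t u v : R).

(** Completeness along the geodesics issued from the root.  It fails in general, for
    instance when arcs of lengths 1/2, 1/4, 1/8 and so on are put end to end. *)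
Definition rays_end := forall (g : R -> point Q) (l : R), 0 < l -> g 0 = O Q ->
  (forall a b, 0 <= a -> a <= b -> b < l -> dist (g a) (g b) = b - a) ->
  exists x, forall a, 0 <= a -> a < l -> dist (g a) x = l - a.

(** The paths of a chain fit together into a ray, whose end point completes it to
    an upper bound of the chain. *)
Lemma chain_limit (A : set (spath Q)) r : rays_end -> A !=set0 ->
  (forall p, A p -> plen p <= r) -> total_on A (@prefix_of R Q) ->
  exists2 q, forall p, A p -> prefix_of p q &
    A q \/ forall p, prefix_of p q -> plen p < plen q ->
      exists2 p', A p' & prefix_of p p' /\ plen p < plen p'.
Proof.
move=> ends [p0 Ap0] Ar Atot; pose l := sup ([set plen p | p in A]).
have ub : has_ubound ([set plen p | p in A]) by exists r => _ [p /Ar ? <-].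
have Al p : A p -> plen p <= l by move=> Ap; apply: ub_le_sup => //; exists p.
have [[q [Aq ql]]|nomax] := pselect (exists q, A q /\ plen q = l).
  exists q; last by left.
  move=> p Ap; have [//|[qp ag]] := Atot _ _ Ap Aq.
  by rewrite (prefix_eq (conj qp ag))//; apply/le_anti; rewrite qp ql Al.
have lt_l p : A p -> plen p < l.
  by move=> Ap; rewrite lt_neqAle Al// andbT; apply/eqP => E; apply: nomax; exists p.
have above a : a < l -> exists2 p, A p & a < plen p.
  by move=> /sup_gt[|_ [p Ap <-] ?]; [exists (plen p0), p0|exists p].
have /choice[f fP] : forall a, exists p, a < l -> A p /\ a < plen p.
  by move=> a; have [/above[p ? ?]|al] := ltP a l; [exists p|exists p0].
pose g a := f a a.
have gE p a : A p -> 0 <= a -> a <= plen p -> g a = p a.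
  move=> Ap a0 ap; have [Af fa] := fP a (le_lt_trans ap (lt_l _ Ap)).
  have [[fp ag]|[pf ag]] := Atot _ _ Af Ap; last by rewrite /g -ag// a0.
  by rewrite /g ag// a0 ltW.
have l0 : 0 < l := le_lt_trans (plen_ge0 p0) (lt_l _ Ap0).
have g0 : g 0 = O Q by rewrite (gE p0)// ?pfun0// plen_ge0.
have gd a b : 0 <= a -> a <= b -> b < l -> dist (g a) (g b) = b - a.
  move=> a0 ab /above[p Ap bp]; rewrite !(gE p)//; first by rewrite pfun_dist// ltW.
  - exact: le_trans ab.
  - exact: ltW.
  - exact/ltW/(le_lt_trans ab).
have [x gx] := ends g l l0 g0 gd.
pose qf t := if t == l then x else if (0 <= t) && (t < l) then g t else O Q.
have qfl t : 0 <= t -> t < l -> qf t = g t.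
  by move=> t0 tl; rewrite /qf lt_eqF// t0 tl.
have q0 : qf 0 = O Q by rewrite qfl.
have qd a b : 0 <= a -> a <= b -> b <= l -> dist (qf a) (qf b) = b - a.
  move=> a0 ab; rewrite le_eqVlt => /predU1P[E|bl]; last first.
    by rewrite !qfl ?gd//; [exact: le_trans ab|exact: le_lt_trans bl].
  move: ab; rewrite E le_eqVlt => /predU1P[->|al]; first by rewrite subrr distxx.
  by rewrite qfl// /qf eqxx gx.
have qo t : t < 0 \/ l < t -> qf t = O Q.
  move=> tl; rewrite /qf; case: eqVneq tl => [->|_]; first by rewrite ltxx => -[|//]; rewrite ltNge ltW.
  by case=> h; case: ifP => // /andP[h1 h2]; exfalso; lra.
have Aq p : A p -> prefix_of p (SPath (ltW l0) q0 qd qo).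
  move=> Ap; split=> /=; first exact: Al.
  by move=> t /andP[t0 tp]; rewrite /= qfl ?(gE p)//; exact: le_lt_trans (lt_l _ Ap).
exists (SPath (ltW l0) q0 qd qo) => //; right => p pq /= /above[p' Ap' pp'].
by exists p' => //; split=> //; apply: prefix_common pq (Aq _ Ap') (ltW _).
Qed.

Section Tree.
Variable G : set (spath Q).
Hypothesis Gt : shortest_path_tree G.
Variable r : R.

Definition ball_tree : set (spath Q) := [set p | G p /\ plen p < r].

Lemma closure_tree p : tree_closure ball_tree p -> G p.
Proof. by move=> cp; apply: (spt_closed Gt) => q qp /(cp _ qp)[]. Qed.

Lemma ball_tree_closure p : ball_tree p -> tree_closure ball_tree p.
Proof.
by move=> [Gp pr] q qp qlt; split; [exact: spt_prefix Gt _ _ Gp qp|exact: lt_trans pr].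
Qed.

Lemma plen_closure p : 0 < r -> tree_closure ball_tree p -> plen p <= r.
Proof.
move=> r0 cp; rewrite leNgt; apply/negP => rp.
pose a := (r + plen p) / 2; have a0 : 0 <= a by rewrite /a; lra.
have ap : a < plen p by rewrite /a; lra.
have := cp _ (trunc_prefix a0 (ltW ap)); rewrite plen_trunc ?(ltW ap)// => /(_ ap)[_].
by rewrite plen_trunc ?(ltW ap)// /a => ?; lra.
Qed.

(** A maximal path above [q] exists by Zorn's lemma, since the limits of chains stay
    in the closure of the tree. *)
Lemma leaf_above q : rays_end -> 0 < r -> ball_tree q ->
  exists2 p, leaf ball_tree p & prefix_of q p.
Proof.
move=> ends r0 /ball_tree_closure cq.
pose T := {p | tree_closure ball_tree p /\ prefix_of q p}.
pose rel (s t : T) := `[< prefix_of (sval s) (sval t) >].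
have [||||[p [cp qp]] pmax] := @Zorn T rel.
- by move=> t; apply/asboolP; exact: prefix_refl.
- by move=> a b c /asboolP ab /asboolP bc; apply/asboolP; exact: prefix_trans ab bc.
- move=> [a ac] [b bc] /asboolP /= ab /asboolP /= ba.
  apply: eq_exist; apply: prefix_eq => //.
  by apply/le_anti; rewrite ab.1 ba.1.
- move=> A Atot; have [[a0 Aa0]|A0] := pselect (A !=set0); last first.
    by exists (exist _ q (conj cq (prefix_refl q))) => s As; exfalso; apply: A0; exists s.
  have [|p [a Aa <-]||p ub pA] := @chain_limit (sval @` A) r ends.
  - by exists (sval a0), a0.
  - by apply: plen_closure => //; case: (svalP a).
  - move=> _ _ [a Aa <-] [b Ab <-].
    by case: (Atot _ _ Aa Ab) => /asboolP; [left|right].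
  have cp : tree_closure ball_tree p.
    case: pA => [[a _ <-]|pA]; first by case: (svalP a).
    move=> p' p'p p'lt; have [_ [a Aa <-] [p'a lt]] := pA _ p'p p'lt.
    by case: (svalP a) => + _; apply.
  have qp : prefix_of q p.
    by apply: (prefix_trans _ (ub (sval a0) _)); [case: (svalP a0)|exists a0].
  by exists (exist _ p (conj cp qp)) => s As; apply/asboolP/ub; exists s.
exists p => //; split=> // p' cp' pp'.
have qp' := prefix_trans qp pp'.
have := pmax (exist _ p' (conj cp' qp')); move=> /(_ (introT (asboolP _) pp')).
by move=> /(congr1 sval).
Qed.

(** At the first time when the tour is above [q] it is at [q]: if it were strictly
    above, it would have been above [q] slightly earlier as well, because it moves
    at unit speed. *)
Lemma tour_passes L (tau : R -> spath Q) q t1 : unit_speed L tau -> plen (tau 0) = 0 ->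
  0 <= t1 <= L -> prefix_of q (tau t1) -> exists2 t, 0 <= t <= L & tau t = q.
Proof.
move=> us tau0 /andP[t10 t1L] qt1.
have [q0|q0] := ltP 0 (plen q); last first.
  have {}q0 : plen q = 0 by apply/le_anti; rewrite q0 plen_ge0.
  exists 0; first by rewrite lexx (le_trans t10).
  apply: spath_eq; first by rewrite q0.
  by move=> t; rewrite tau0 => /le_anti <-; rewrite !pfun0.
pose E := [set u | 0 <= u <= t1 /\ prefix_of q (tau u)]; pose a := inf E.
have E1 : E t1 by split; rewrite ?t10 ?lexx.
have lbE : has_lbound E by exists 0 => u [/andP[]].
have a0 : 0 <= a by apply: lb_le_inf; [exists t1|move=> u [/andP[]]].
have at1 : a <= t1 by exact: ge_inf.
have aL : 0 <= a <= L by rewrite a0 (le_trans at1).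
have [e e0 near] := us a aL.
have qa : prefix_of q (tau a).
  have close c : 0 < c -> exists2 u, prefix_of q (tau u) & tree_dist (tau a) (tau u) < c.
    move=> c0; have [u [/andP[u0 ut1] qu] ua] : exists2 u, E u & u < a + Num.min e c.
      by apply: inf_lt; [exists t1|rewrite ltrDl lt_min e0].
    have au : a <= u by apply: ge_inf => //; split=> //; rewrite u0.
    exists u => //; have d : `|u - a| < Num.min e c by rewrite ger0_norm ?subr_ge0// ltrBlDl.
    by move: d; rewrite lt_min => /andP[de dc]; rewrite near// u0 (le_trans ut1).
  have below c : 0 < c -> exists u, [/\ prefix_of q (tau u),
      plen q - c < meet_depth (tau a) (tau u) & meet_depth (tau a) (tau u) <= plen (tau a)].
    move=> /close[u qu du]; exists u; split=> //; last by case: (meet_le_plen (tau a) (tau u)).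
    by have := tree_dist_plen (tau a) (tau u); case: qu => ? _; lra.
  have qa : plen q <= plen (tau a).
    by apply/ler_addgt0Pr => c /below[u [_ ? ?]]; lra.
  split=> //; apply: (agree_on_closed Qc Qn) => // u u0 uq.
  have [v [qv mv _]] := below (plen q - u) ltac:(by rewrite subr_gt0).
  have um : u < meet_depth (tau a) (tau v) by move: mv; rewrite opprB addrCA subrr addr0.
  have ag := agree_on_sym (meet_agree um); apply: agree_on_trans ag.
  by case: qv => _; exact/agree_on_le/ltW.
exists a => //; case: (qa) => [qla _]; apply/esym/prefix_eq => //.
apply/le_anti; rewrite qla /= leNgt; apply/negP => lt.
have {}a0 : 0 < a.
  by rewrite lt_neqAle a0 andbT; apply/eqP => E0; move: lt; rewrite -E0 tau0 ltNge plen_ge0.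
pose c := Num.min a (Num.min (e / 2) ((plen (tau a) - plen q) / 2)).
have c0 : 0 < c by rewrite /c !lt_min a0; apply/andP; split; lra.
have [ca ce cp] : [/\ c <= a, c <= e / 2 & c <= (plen (tau a) - plen q) / 2].
  by rewrite /c !ge_min !lexx !orbT; split.
have : E (a - c).
  split; first by apply/andP; split; lra.
  have d : `|a - c - a| = c by rewrite addrAC subrr add0r normrN gtr0_norm.
  have := near (a - c); rewrite d => nE.
  have {}nE : tree_dist (tau a) (tau (a - c)) = c.
    by apply: nE; [apply/andP; split; case/andP: aL; lra|lra].
  have := tree_dist_plen (tau (a - c)) (tau a); rewrite tree_distC nE => /andP[_ h].
  have qm : plen q < meet_depth (tau (a - c)) (tau a) by lra.
  split; first by apply: le_trans (ltW qm) _; case: (meet_le_plen (tau (a - c)) (tau a)).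
  by apply: agree_on_trans (agree_on_sym (meet_agree qm)); case: qa.
by move=> /(ge_inf lbE); rewrite -/a; lra.
Qed.

Lemma tour_visits (S : tour Q) q : rays_end -> 0 < r -> depth_first_tour ball_tree S ->
  ball_tree q -> exists2 t, 0 <= t <= S.1 & S.2 t = q.
Proof.
move=> ends r0 dfS Tq; have [p lp qp] := leaf_above ends r0 Tq.
have [t tS tp] := dft_leaves dfS lp.
by apply: (tour_passes (dft_speed dfS) (dft_start dfS) tS); rewrite tp.
Qed.

(** The duration of a depth-first tour is twice the total length of the branches
    by which it climbs between the times of a fine subdivision.  No climb repeats
    another: a common point would, by the depth-first order, also be an
    ancestor of the starting point of the later climb. *)
Lemma tour_branches (S : tour Q) : depth_first_tour ball_tree S ->
  exists (M : nat) (m : nat -> R) (p : nat -> spath Q),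
   [/\ S.1 = 2 * \sum_(i < M) (plen (p i) - m i),
       forall i, (i < M)%N -> tree_closure ball_tree (p i) /\ 0 <= m i <= plen (p i) &
       forall i j t, (i < j)%N -> (j < M)%N -> m i < t <= plen (p i) ->
         m j < t <= plen (p j) -> ~ agree_on (p i) (p j) 0 t].
Proof.
case: S => L tau dfS; have L0 := dft_dur dfS; have us := dft_speed dfS; rewrite /= in L0 us.
(* The unit speed is only local; a supremum argument provides a subdivision of
   [[0, L]] between whose consecutive times the distance moved is the time elapsed. *)
pose C u := exists M (s : nat -> R), [/\ s 0%N = 0, s M = u &
  forall i, (i < M)%N -> s i <= s i.+1 /\ tree_dist (tau (s i)) (tau (s i.+1)) = s i.+1 - s i].
have C0 : C 0 by exists 0%N, (fun=> 0).
have CS u v : C u -> u <= v -> tree_dist (tau u) (tau v) = v - u -> C v.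
  move=> [M [s [s0 sM sS]]] uv d.
  exists M.+1, (fun i => if (i <= M)%N then s i else v); split=> [//||i]; first by rewrite ltnn.
  move=> iM; have : (i == M) || (i < M)%N by rewrite -leq_eqVlt.
  move=> /predU1P[->|{}iM]; first by rewrite /= leqnn ltnn sM.
  by rewrite /= (ltnW iM) iM; exact: sS.
have CL : C L.
  pose E := [set u | 0 <= u <= L /\ C u]; pose a := sup E.
  have E0 : E 0 by split; rewrite // lexx L0.
  have ubE : has_ubound E by exists L => u [/andP[]].
  have a0 : 0 <= a by exact: ub_le_sup.
  have aL : a <= L by apply: ge_sup; [exists 0|move=> u [/andP[]]].
  have [e e0 near] := us a ltac:(by rewrite a0).
  have Ca : C a.
    have [u [/andP[u0 uL] Cu] ua] : exists2 u, E u & a - e < u.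
      by apply: sup_gt; [exists 0|rewrite ltrBlDr ltrDl].
    have le : u <= a by apply: ub_le_sup => //; split=> //; rewrite u0.
    apply: (CS u) => //; rewrite tree_distC near ?u0// distrC ger0_norm ?subr_ge0//.
    by lra.
  have [->//|La] := eqVneq L a.
  have {La}aL : a < L by rewrite lt_neqAle eq_sym La.
  pose v := Num.min L (a + e / 2).
  have [vL ve] : v <= L /\ v <= a + e / 2 by rewrite /v !ge_min !lexx orbT.
  have av : a < v by rewrite /v lt_min aL; lra.
  have Cv : C v.
    apply: (CS a) => //; first exact: ltW.
    have d : `|v - a| = v - a by rewrite gtr0_norm// subr_gt0.
    by rewrite near ?d//; [apply/andP; split; lra|lra].
  have : v <= a by apply: ub_le_sup => //; split=> //; apply/andP; split; lra.
  by rewrite leNgt av.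
case: CL => M [s [s0 sM sS]].
have mono i j : (i <= j)%N -> (j <= M)%N -> s i <= s j.
  elim: j => [|j IH]; first by rewrite leqn0 => /eqP ->.
  rewrite leq_eqVlt => /predU1P[->//|ij] jM.
  by apply: le_trans (sS _ jM).1; apply: IH => //; exact: ltnW.
have sL i : (i <= M)%N -> 0 <= s i <= L.
  by move=> iM; rewrite -s0 -sM !mono.
exists M, (fun i => meet_depth (tau (s i)) (tau (s i.+1))), (fun i => tau (s i.+1)); split.
- rewrite /=; have -> : L = \sum_(i < M) tree_dist (tau (s i)) (tau (s i.+1)).
    have -> : L = \sum_(i < M) (s i.+1 - s i).
      by rewrite -(big_mkord xpredT (fun i => s i.+1 - s i)) telescope_sumr// sM s0 subr0.
    by apply: eq_bigr => i _; rewrite (sS _ (ltn_ord i)).2.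
  have up : \sum_(i < M) (plen (tau (s i.+1)) - plen (tau (s i))) = 0.
    rewrite -(big_mkord xpredT (fun i => plen (tau (s i.+1)) - plen (tau (s i)))).
    rewrite (telescope_sumr (fun i => plen (tau (s i))))// sM s0.
    by rewrite (dft_end dfS : plen (tau L) = 0) (dft_start dfS : plen (tau 0) = 0) subrr.
  rewrite mulr_sumr -[RHS]subr0 -[X in _ = _ - X]up -sumrB /=; apply: eq_bigr => i _.
  by rewrite /tree_dist mulr2n; ring.
- move=> i iM; split; first by apply: (dft_in dfS); exact: sL.
  by rewrite meet_ge0; case: (meet_le_plen (tau (s i)) (tau (s i.+1))).
move=> i j t ij jM /andP[mi ti] /andP[mj tj] ag.
have t0 : 0 <= t by apply: le_trans (ltW mi); exact: meet_ge0.
have pj1 : prefix_of (trunc (tau (s i.+1)) t) (tau (s j.+1)).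
  split; rewrite plen_trunc//; apply: agree_on_trans ag; exact: trunc_agree.
have pi1 := trunc_prefix t0 ti.
have pj : prefix_of (trunc (tau (s i.+1)) t) (tau (s j)).
  apply: (dft_order dfS (t1 := s i.+1) (t3 := s j.+1)) => //.
  - by case/andP: (sL i.+1 (leq_trans ij (ltnW jM))).
  - exact/mono/ltnW.
  - exact/mono.
  - by case/andP: (sL j.+1 jM).
have : t <= meet_depth (tau (s j)) (tau (s j.+1)).
  case: pj pj1; rewrite plen_trunc// => tj' ag1 [_ ag2].
  apply: le_meet => //; apply: agree_on_trans (agree_on_sym ag1) _.
  by rewrite plen_trunc in ag2.
by rewrite leNgt mj.
Qed.

End Tree.
End Tours.


(** * Length of the network within a given depth *)

Section Length.
Variables (R : realType) (Q : metric_graph R) (N : nat).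
Hypothesis Qc : connected_graph Q.
Hypothesis Qn : levels_bounded_by Q N.
Variable code : arc Q * bool -> nat.
Hypothesis codeI : forall h h', half_nonempty h -> half_nonempty h' ->
  code h = code h' -> h = h'.
Implicit Types (x y z : point Q) (p q : spath Q).

Let mu := @lebesgue_measure R.

Definition coded_half k : set R := [set t | exists2 h, code h = k & in_half h t].

Definition half_length k r : \bar R := mu (coded_half k `&` `[0, r]).

(** The length of the part of the network at depth at most [r]; only vertices and
    peaks of arcs lie outside the halves, and the depth is an isometry on each half. *)
Definition length_within r : \bar R := (\sum_(0 <= k <oo) half_length k r)%E.

Lemma coded_halfE k h t : code h = k -> in_half h t -> coded_half k = [set u | in_half h u].
Proof.
move=> hk ht; apply/seteqP; split=> u /=; last by exists h.
case=> h' h'k h'u; suff -> : h = h' by [].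
by apply: codeI; rewrite ?hk ?h'k//; [exists t|exists u].
Qed.

Lemma measurable_coded_half k : measurable (coded_half k).
Proof.
have [[t [h hk ht]]|k0] := pselect (coded_half k !=set0); last first.
  suff -> : coded_half k = set0 by [].
  by apply/seteqP; split=> // t kt; apply: k0; exists t.
rewrite (coded_halfE hk ht).
have -> : [set u | in_half h u] = `]lo h, +oo[ `&` [set u | (u%:E < hi h)%E].
  by apply/seteqP; split=> u /=; rewrite in_itv /= andbT /in_half; [move=> /andP|case=> -> ->].
apply: measurableI => //; case: (hi h) => [b| |].
- suff -> : [set u : R | (u%:E < b%:E)%E] = `]-oo, b[%classic by [].
  by apply/seteqP; split=> u /=; rewrite in_itv /= lte_fin.
- suff -> : [set u : R | (u%:E < +oo)%E] = setT by [].
  by apply/seteqP; split=> u //= _; exact: ltry.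
- suff -> : [set u : R | (u%:E < -oo)%E] = set0 by [].
  by apply/seteqP; split=> u.
Qed.

Lemma length_within_ge0 r : (0 <= length_within r)%E.
Proof. by apply: nneseries_ge0 => k _ _; exact: measure_ge0. Qed.

Lemma half_length_mono k r s : r <= s -> (half_length k r <= half_length k s)%E.
Proof.
move=> rs; apply: le_measure; rewrite ?inE.
- by apply: measurableI => //; exact: measurable_coded_half.
- by apply: measurableI => //; exact: measurable_coded_half.
- by apply: setIS => t /=; rewrite !in_itv /= => /andP[-> /le_trans]; apply.
Qed.

Lemma half_length_fin k r : half_length k r \is a fin_num.
Proof.
rewrite ge0_fin_numE; last exact: measure_ge0.
apply: (@le_lt_trans _ _ (mu `[0, r]%classic)).
  apply: le_measure; rewrite ?inE; [|exact: measurable_itv|exact: subIsetr].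
  by apply: measurableI => //; exact: measurable_coded_half.
by rewrite /mu lebesgue_measure_itv /=; case: ifP => _; rewrite -?EFinB ltry.
Qed.

Lemma measurable_half_length k : measurable_fun [set: R] (half_length k : R -> \bar R).
Proof.
have -> : half_length k = EFin \o (fun r => fine (half_length k r)).
  by apply/funext => r /=; rewrite fineK// half_length_fin.
apply/measurable_EFinP; apply: nondecreasing_measurable => // r s rs.
by apply: fine_le; rewrite ?half_length_fin// half_length_mono.
Qed.

Lemma measurable_length_within : measurable_fun [set: R] (length_within : R -> \bar R).
Proof.
have := @ge0_emeasurable_sum _ (measurableTypeR R) R setT (fun k r => half_length k r) xpredT.
apply=> [k r _ _|k _]; first exact: measure_ge0.
exact: measurable_half_length.
Qed.

Lemma sum_uniq_le_nneseries (F : nat -> \bar R) (ks : seq nat) : uniq ks ->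
  (forall k, 0 <= F k)%E -> (\sum_(k <- ks) F k <= \sum_(0 <= k <oo) F k)%E.
Proof.
move=> uks F0; pose K := (\max_(k <- ks) k).+1.
have perm : perm_eq ks [seq k <- iota 0 K | k \in ks].
  apply: uniq_perm => // [|k]; first by rewrite filter_uniq ?iota_uniq.
  rewrite mem_filter mem_iota /= add0n; case kks: (k \in ks) => //=.
  by rewrite /K ltnS leq_bigmax_seq.
rewrite (perm_big _ perm) big_filter.
apply: le_trans (nneseries_lim_ge K _) => //.
rewrite /index_iota subn0 [leRHS](bigID (mem ks)) /=.
by rewrite leeDl// sume_ge0.
Qed.

Section Tree.
Variable G : set (spath Q).
Hypothesis Gt : shortest_path_tree G.

(** The climbs that cross level [t] do so at distinct points of the tree, hence at
    distinct points of the network, and these lie in distinct halves. *)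
Lemma branches_le_halves (M : nat) (m : nat -> R) (p : nat -> spath Q) t :
  (forall i, (i < M)%N -> G (p i) /\ 0 <= m i <= plen (p i)) ->
  (forall i j, (i < j)%N -> (j < M)%N -> m i < t <= plen (p i) ->
     m j < t <= plen (p j) -> ~ agree_on (p i) (p j) 0 t) ->
  ~ half_ends Q t ->
  (\sum_(i < M) (\1_(`]m i, plen (p i)]) t)%:E <=
   \sum_(0 <= k <oo) (\1_(coded_half k) t)%:E :> \bar R)%E.
Proof.
move=> pG pI nt; pose I := [seq i <- iota 0 M | m i < t <= plen (p i)].
have IP i : i \in I -> [/\ (i < M)%N, m i < t, t <= plen (p i) & 0 <= t].
  rewrite mem_filter mem_iota /= add0n => /andP[/andP[mt tp] iM]; split=> //.
  by have [_ /andP[/le_trans + _]] := pG _ iM; apply; exact: ltW.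
have /choice[f fP] : forall i, exists k, i \in I -> exists h,
    [/\ code h = k, in_half h t & pend (trunc (p i) t) = half_point h t].
  move=> i; have [/IP[iM mt tp t0]|_] := boolP (i \in I); last by exists 0%N.
  have t0' : 0 < t by have [_ /andP[mi0 _]] := pG _ iM; exact: le_lt_trans mt.
  have dt : depth (pend (trunc (p i) t)) = t by rewrite depth_pend// plen_trunc.
  have [h] : exists2 h, in_half h (depth (pend (trunc (p i) t))) &
      pend (trunc (p i) t) = half_point h (depth (pend (trunc (p i) t))).
    by apply: (depth_in_half Qc); rewrite dt.
  by rewrite dt => ih E; exists (code h) => _; exists h.
have fI : {in I &, injective f}.
  move=> i j iI jI fij; have [iM mi ti t0] := IP _ iI; have [jM mj tj _] := IP _ jI.
  have [h [hi ih Ei]] := fP _ iI; have [h' [hj jh Ej]] := fP _ jI.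
  have hh : h = h' by apply: codeI; [exists t|exists t|rewrite hi hj].
  have [Gi _] := pG _ iM; have [Gj _] := pG _ jM.
  have eq : trunc (p i) t = trunc (p j) t.
    apply: (pend_inj Qc Gt); rewrite ?plen_trunc//; last by rewrite Ei Ej hh.
    - exact: spt_prefix Gt _ _ Gi (trunc_prefix t0 ti).
    - exact: spt_prefix Gt _ _ Gj (trunc_prefix t0 tj).
  have ag : agree_on (p i) (p j) 0 t.
    apply: agree_on_trans (agree_on_sym (trunc_agree t0 ti)) _.
    by rewrite eq; exact: trunc_agree.
  apply/eqP; case: ltngtP => // ij.
  - by exfalso; apply: (pI i j) => //; rewrite ?mi ?mj.
  - by exfalso; apply: (pI j i) => //; rewrite ?mi ?mj//; exact: agree_on_sym.
have uI : uniq I by rewrite filter_uniq ?iota_uniq.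
apply: le_trans (sum_uniq_le_nneseries (ks := map f I) _ _); last 2 first.
- by rewrite map_inj_in_uniq.
- by move=> k; rewrite lee_fin.
have -> : (\sum_(k <- map f I) (\1_(coded_half k) t)%:E = \sum_(i <- I) 1 :> \bar R)%E.
  rewrite big_map big_seq [RHS]big_seq; apply: eq_bigr => i iI.
  by have [h [hk ih _]] := fP _ iI; rewrite indicE mem_set//; exists h.
rewrite -(big_mkord xpredT (fun i => (\1_(`]m i, plen (p i)]) t)%:E)) /index_iota subn0.
rewrite big_filter [leRHS]big_mkcond; apply: lee_sum => i _.
by rewrite indicE mem_setE in_itv /=; case: ifP.
Qed.

(** Integrate the preceding bound over all levels; the exceptional ones form a
    countable, hence negligible, set. *)
Lemma tour_duration r (S : tour Q) : 0 < r -> depth_first_tour (ball_tree G r) S ->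
  ((S.1)%:E <= 2%:E * length_within r)%E.
Proof.
move=> r0 /(tour_branches)[M [m [p [-> pG pI]]]].
rewrite EFinM lee_pmul2l//; rewrite -sumEFin.
have mG i : (i < M)%N -> G (p i) /\ 0 <= m i <= plen (p i).
  by move=> /pG[/(closure_tree Gt) ? ?].
have mI k : measurable_fun `[0, r] (fun t => (\1_(coded_half k) t)%:E : \bar R).
  by apply/measurable_EFinP/measurable_indic; exact: measurable_coded_half.
apply: (@le_trans _ _ (\int[mu]_(t in `[0%R, r]) \sum_(i < M) (\1_(`]m i, plen (p i)]) t)%:E)%E).
  rewrite ge0_integral_sum//=; last first.
    by move=> i; apply/measurable_EFinP/measurable_indic.
  apply: lee_sum => i _; rewrite integral_indic//.
  have [cp /andP[m0 mp]] := pG _ (ltn_ord i).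
  rewrite setIidl; last first.
    move=> t /=; rewrite !in_itv /= => /andP[mt tp]; rewrite (le_trans m0 (ltW mt)) /=.
    by apply: le_trans tp _; exact: plen_closure cp.
  rewrite [leRHS](lebesgue_measure_itv `]m i, plen (p i)]) /= lte_fin; case: ltP => // pm.
  by rewrite lee_fin subr_le0.
apply: (@le_trans _ _ (\int[mu]_(t in `[0%R, r]) \sum_(0 <= k <oo) (\1_(coded_half k) t)%:E)%E).
  apply: ae_ge0_le_integral => //.
  - by move=> t _; apply: sume_ge0 => i _; rewrite lee_fin.
  - by apply: emeasurable_sum => i; apply/measurable_EFinP/measurable_indic.
  - by move=> t _; apply: nneseries_ge0 => k _ _; rewrite lee_fin.
  - have := @ge0_emeasurable_sum _ (measurableTypeR R) R `[0, r]%classic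
      (fun k t => (\1_(coded_half k) t)%:E) xpredT.
    by apply=> [k t _ _|k _]; [rewrite lee_fin|exact: mI].
  exists (half_ends Q); split.
  - by apply: countable_measurable => //; exact: half_ends_countable Qc Qn.
  - by apply: countable_lebesgue_measure0; exact: half_ends_countable Qc Qn.
  move=> t /= H; apply: contrapT => nt; apply: H => _.
  by apply: branches_le_halves => // i j ij jM; exact: pI.
rewrite integral_nneseries//.
by apply: lee_nneseries => k _; rewrite ?integral_indic//; exact: measurable_coded_half.
Qed.

End Tree.
End Length.


(** * Separated points that sample the length *)

Section Packing.
Variables (R : realType) (Q : metric_graph R).
Hypothesis Qc : connected_graph Q.
Variable code : arc Q * bool -> nat.
Hypothesis codeI : forall h h', half_nonempty h -> half_nonempty h' ->
  code h = code h' -> h = h'.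

Lemma spaced_count (n : nat) (d a v : R) : 0 < d -> v - a < n%:R * d ->
  v - a <= d * \sum_(j < n) (a + j%:R * d <= v)%R%:R.
Proof.
move=> d0 vn; have [va|av] := ltP v a.
  apply: le_trans (_ : 0 <= _); first by rewrite subr_le0 ltW.
  by rewrite mulr_ge0 ?(ltW d0)// sumr_ge0.
pose q := Num.truncn ((v - a) / d).
have /andP[q1 q2] : q%:R <= (v - a) / d < q.+1%:R.
  by apply: truncn_itv; rewrite divr_ge0 ?subr_ge0// ltW.
rewrite ler_pdivlMr// in q1; rewrite ltr_pdivrMr// in q2.
have qn : (q < n)%N by rewrite -(ltr_nat R) -(ltr_pM2r d0); lra.
rewrite (le_trans (ltW q2))// mulrC ler_pM2l//.
rewrite -(big_mkord xpredT (fun j => (a + j%:R * d <= v)%R%:R)) (big_cat_nat (n := q.+1))//=.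
rewrite -[leLHS]addr0 lerD ?sumr_ge0//.
have -> : q.+1%:R = \sum_(0 <= j < q.+1) 1 :> R by rewrite sumr_const_nat subn0.
apply: ler_sum_nat => j /andP[_ jq].
suff -> : a + j%:R * d <= v by [].
have : j%:R * d <= q%:R * d by rewrite ler_pM2r// ler_nat.
lra.
Qed.

(** Points evenly spaced along halves shortened by a margin [g] at both ends. The
    margin keeps points of different halves apart, and costs at most [2 * g] of
    length per half. *)
Lemma packing (K : nat) (r e : R) : 0 < r -> 0 < e ->
  exists d, [/\ 0 < d, d <= e & exists (n : nat) (P : pred ('I_K * 'I_n))
    (X : 'I_K * 'I_n -> point Q),
  [/\ forall i, P i -> 0 < depth (X i) <= r,
      forall i j, P i -> P j -> i != j -> d <= dist (X i) (X j) &
      forall y, 0 <= y -> y <= r ->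
        (\sum_(k < K) half_length code k y <=
          (d * (\sum_(i | P i) (depth (X i) <= y)%R%:R) + e)%:E)%E]].
Proof.
move=> r0 e0.
pose g := e / (2 * K.+1%:R); have g0 : 0 < g by rewrite divr_gt0// mulr_gt0.
pose d := g / 2; have d0 : 0 < d by rewrite divr_gt0.
have Kg : K%:R * (2 * g) <= e.
  rewrite /g; have -> : K%:R * (2 * (e / (2 * K.+1%:R))) = e * (K%:R / K.+1%:R) :> R by field.
  by rewrite ler_piMr ?(ltW e0)// ler_pdivrMr// mul1r ler_nat.
have de : d <= e.
  have : g <= e.
    by rewrite /g ler_pdivrMr ?mulr_gt0// ler_peMr ?(ltW e0)// -natrM ler1n.
  by rewrite /d; lra.
exists d; split=> //.
pose ne k := coded_half code k !=set0.
have [[hh0 hhP]|noarc] := pselect (exists hh : nat -> arc Q * bool, forall k, ne k ->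
    coded_half code k = [set t | in_half (hh k) t] /\ code (hh k) = k); last first.
  have noh : arc Q * bool -> False.
    move=> h0; apply: noarc; suff /choice[hh] : forall k, exists h, ne k ->
        coded_half code k = [set t | in_half h t] /\ code h = k by exists hh.
    move=> k; have [[t [h hk ht]]|nk] := pselect (ne k); last by exists h0.
    by exists h => _; rewrite (coded_halfE codeI hk ht).
  exists 0%N, xpredT, (fun=> O Q); split=> [[_ []//]|[_ []//]|y _ _].
  rewrite big1 => [|k _]; first by rewrite lee_fin addr_ge0 ?mulr_ge0 ?(ltW d0) ?(ltW e0)// sumr_ge0.
  rewrite /half_length (_ : coded_half code k = set0) ?set0I ?measure0//.
  by apply/seteqP; split=> // t [h _ _]; case: (noh h).
pose a k := lo (hh0 k) + g.
pose b k := (if hi (hh0 k) is c%:E then Num.min c r else r) - g.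
pose n := (Num.truncn (r / d)).+1.
exists n, (fun kj : 'I_K * 'I_n => `[< ne kj.1 >] && (a kj.1 + kj.2%:R * d <= b kj.1)),
  (fun kj : 'I_K * 'I_n => half_point (hh0 kj.1) (a kj.1 + kj.2%:R * d)).
have inP k (j : nat) c : - g < c -> c < g -> ne k -> a k + j%:R * d <= b k ->
    in_half (hh0 k) (a k + j%:R * d + c).
  move=> gc cg nk; rewrite /a /b /in_half => ab.
  have jd : 0 <= j%:R * d :> R by rewrite mulr_ge0// ltW.
  apply/andP; split; first lra.
  have nk' := nk; case hk: (hi (hh0 k)) ab => [u| |] ab; last 2 first.
  - exact: ltry.
  - by case: nk => t; rewrite (hhP _ nk').1 /= /in_half hk lte_fin_Ny andbF.
  by rewrite lte_fin; move: ab; rewrite lerBrDr le_min => /andP[? _]; lra.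
have br k : b k <= r - g.
  by rewrite /b; case: (hi _) => [u| |]; rewrite lerD2r// ge_min lexx orbT.
have dg : d < g by rewrite /d; lra.
have in0 k (j : nat) : ne k -> a k + j%:R * d <= b k -> in_half (hh0 k) (a k + j%:R * d).
  by move=> nk ab; rewrite -[X in in_half _ X]addr0; apply: inP => //; lra.
split.
- move=> [k j] /= /andP[/asboolP nk ab]; have ih := in0 _ _ nk ab.
  rewrite (depth_half Qc ih) (in_half_gt0 Qc ih) /=.
  by apply: le_trans ab _; apply: le_trans (br k) _; lra.
- move=> [k j] [k' j'] /= /andP[/asboolP nk ab] /andP[/asboolP nk' ab'] ne_kj.
  have [kk|kk] := eqVneq k k'; last first.
    have [dg1 dg2 dg3] : [/\ - g < d, d < g & - d < g] by split; lra.
    have dg4 : - g < - d by lra.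
    apply: (half_points_far Qc d0); [exact: inP|exact: inP|exact: inP|exact: inP|].
    move=> E; move: kk => /eqP; apply; apply: val_inj.
    by rewrite /= -(hhP _ nk).2 -(hhP _ nk').2 E.
  rewrite -{k'}kk in nk' ab' ne_kj *.
  have jj : j != j' by apply: contraNneq ne_kj => ->.
  wlog jj' : j j' ab ab' {ne_kj jj} / (j < j')%N.
    move=> H; have [lt|lt|/val_inj E] := ltngtP j j'; first exact: H.
      by rewrite dist_sym//; exact: H.
    by rewrite E eqxx in jj.
  rewrite dist_sym//; apply: le_trans (depth_dist Qc _ _).
  rewrite !(depth_half Qc) ?in0//.
  have : j.+1%:R * d <= j'%:R * d by rewrite ler_pM2r// ler_nat.
  by rewrite -natr1; lra.
move=> y y0 yr.
have -> : \sum_(i : 'I_K * 'I_n | `[< ne i.1 >] && (a i.1 + i.2%:R * d <= b i.1))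
    (depth (half_point (hh0 i.1) (a i.1 + i.2%:R * d)) <= y)%R%:R
  = \sum_(k < K | `[< ne k >]) \sum_(j < n) (a k + j%:R * d <= Num.min y (b k))%R%:R :> R.
  rewrite -(pair_big_dep (fun k : 'I_K => `[< ne k >]) (fun (k : 'I_K) (j : 'I_n) => a k + j%:R * d <= b k)
    (fun (k : 'I_K) (j : 'I_n) => (depth (half_point (hh0 k) (a k + j%:R * d)) <= y)%R%:R)) /=.
  apply: eq_bigr => k /asboolP nk; rewrite big_mkcond; apply: eq_bigr => j _.
  by rewrite le_min andbC; case: ifP => // ab; rewrite (depth_half Qc (in0 _ _ nk ab)).
apply: (@le_trans _ _ (\sum_(k < K) (d * (if `[< ne k >] then
    \sum_(j < n) (a k + j%:R * d <= Num.min y (b k))%R%:R else 0) + 2 * g)%:E)%E).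
  apply: lee_sum => k _; case: asboolP => nk; last first.
    rewrite /half_length (_ : coded_half code k = set0) ?set0I ?measure0 ?lee_fin; last first.
      by apply/seteqP; split=> // t kt; apply: nk; exists t.
    by lra.
  set v := Num.min y (b k); set S := \sum_(j < n) _.
  have vS : v - a k <= d * S.
    apply: spaced_count => //; have := truncn_itv (divr_ge0 (ltW r0) (ltW d0)).
    move=> /andP[_]; rewrite ltr_pdivrMr// -/n => rn.
    have := lo_ge0 Qc (hh0 k); have vy : v <= y by rewrite /v ge_min lexx.
    by rewrite /a; lra.
  have sub : coded_half code k `&` `[0, y] `<=` `[lo (hh0 k), v + g].
    rewrite (hhP _ nk).1 => t [/andP[lot thi]] /=; rewrite !in_itv /= => /andP[t0 ty].
    rewrite (ltW lot) /= -lerBlDr /v le_min; apply/andP; split; first lra.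
    rewrite /b lerD2r; case: (hi _) thi => [u| |] //; last by move=> _; lra.
    by rewrite lte_fin le_min => tu; rewrite (ltW tu); lra.
  apply: (@le_trans _ _ (lebesgue_measure `[lo (hh0 k), v + g]%classic)).
    apply: le_measure; rewrite ?inE//; apply: measurableI => //.
    exact: measurable_coded_half.
  rewrite lebesgue_measure_itv /= lte_fin; case: ltP => _.
    by rewrite -EFinB lee_fin; rewrite /a in vS; lra.
  have S0 : 0 <= S by apply: sumr_ge0.
  by rewrite lee_fin; apply: addr_ge0; apply: mulr_ge0 => //; exact: ltW.
rewrite sumEFin lee_fin big_split /= -mulr_sumr -big_mkcond /= lerD2l.
by rewrite sumr_const card_ord -[X in X <= _]mulr_natl.
Qed.

End Packing.


(** * What a search of bounded ratio entails *)

Lemma le_nonneg_integral d (T : measurableType d) (R : realType)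
    (mu : {measure set T -> \bar R}) (f g : T -> \bar R) :
  (forall x, 0 <= f x)%E -> (forall x, f x <= g x)%E ->
  (\int[mu]_x f x <= \int[mu]_x g x)%E.
Proof.
move=> f0 fg; have g0 x : (0 <= g x)%E by exact: le_trans (fg x).
rewrite !ge0_integralTE//; apply: ereal_sup_le => _ [h hf <-].
by exists h => // x; exact: le_trans (fg x).
Qed.

(** In increasing order, the [i]-th value is at least [(i - 1) * c]; by induction,
    removing the largest value. *)
Lemma separated_sum (R : realType) (I : finType) (f : I -> R) c n (A : {set I}) : #|A| = n ->
  (forall i, i \in A -> 0 <= f i) ->
  (forall i j, i \in A -> j \in A -> i != j -> c <= `|f i - f j|) ->
  c * (n%:R * (n%:R - 1)) / 2 <= \sum_(i in A) f i /\
  ((0 < n)%N -> exists2 i, i \in A & (n%:R - 1) * c <= f i).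
Proof.
elim: n A => [|n IH] A An f0 fc.
  by split=> //; rewrite mul0r mulr0 mul0r sumr_ge0.
have [i0 i0A] : exists i, i \in A by apply/card_gt0P; rewrite An.
pose m := [arg max_(i > i0 in A) f i]%O.
have [mA mmax] : m \in A /\ forall i, i \in A -> f i <= f m by rewrite /m; case: arg_maxP.
have [|i /setD1P[_ /f0]//|i j /setD1P[_ iA] /setD1P[_ jA]|IHs IHm] := IH (A :\ m).
- by have := cardsD1 m A; rewrite mA An => -[].
- exact: fc.
have fm : n%:R * c <= f m.
  case: n {IH An IHs} IHm => [_|n /(_ isT)[i /setD1P[im iA] fi]].
    by rewrite mul0r; exact: f0.
  have := fc _ _ mA iA; rewrite eq_sym => /(_ im); have := mmax _ iA => mi.
  by rewrite ger0_norm ?subr_ge0//; move: fi; rewrite -natr1; lra.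
split; last by move=> _; exists m => //; rewrite -natr1; lra.
by rewrite (big_setD1 m)//= -natr1; move: IHs fm; lra.
Qed.

Section LowerBound.
Variables (R : realType) (Q : metric_graph R).
Hypothesis Qc : connected_graph Q.
Implicit Types (x y z : point Q) (S : search Q).

Lemma search_lip S t1 t2 : 0 <= t1 -> t1 <= t2 -> dist (S t1) (S t2) <= t2 - t1.
Proof.
by move=> t0; rewrite le_eqVlt => /predU1P[->|/trace_lip]; [rewrite subrr distxx|exact].
Qed.

Lemma search_lip_abs S t1 t2 : 0 <= t1 -> 0 <= t2 -> dist (S t1) (S t2) <= `|t1 - t2|.
Proof.
move=> t10 t20; have [le|/ltW le] := leP t1 t2.
  by rewrite distrC ger0_norm ?subr_ge0//; exact: search_lip.
by rewrite dist_sym// ger0_norm ?subr_ge0//; exact: search_lip.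
Qed.

(** A measurable substitute for the search time, that never exceeds it: the first
    multiple of [g] at which the searcher is within [g] of the point. *)
Definition sampled_time (g : R) x (S : search Q) : \bar R :=
  einfs (fun i => if dist (S (i%:R * g)) x < g then (i%:R * g)%:E else +oo%E) 0.

Lemma sampled_time_ge0 g x S : 0 <= g -> (0 <= sampled_time g x S)%E.
Proof.
move=> g0; apply: le_ereal_inf_tmp => _ [i _ <-]; case: ifP => _; last exact: leey.
by rewrite lee_fin mulr_ge0.
Qed.

Lemma measurable_sampled_time g x : 0 <= g ->
  measurable_fun [set: search_space Q] (sampled_time g x : search_space Q -> \bar R).
Proof.
move=> g0; apply: measurable_fun_einfs => i.
apply: measurable_fun_ifT; [|exact: measurable_cst|exact: measurable_cst].
apply: (measurable_fun_bool true); rewrite setTI; apply: sub_sigma_algebra.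
by exists (i%:R * g), x, g; rewrite mulr_ge0.
Qed.

Lemma sampled_time_le g x S : 0 < g -> (sampled_time g x S <= search_time S x)%E.
Proof.
move=> g0; apply: le_ereal_inf_tmp => _ [t [t0 St] <-].
have tg0 : 0 <= t / g by rewrite divr_ge0// ltW.
have /andP[h1 h2] := truncn_itv tg0; set i := Num.truncn (t / g) in h1 h2.
rewrite ler_pdivlMr// in h1; rewrite ltr_pdivrMr// -natr1 in h2.
apply: (@le_trans _ _ (i%:R * g)%:E); last by rewrite lee_fin.
apply: ereal_inf_lbound; exists i => //=.
suff -> : dist (S (i%:R * g)) x < g by [].
rewrite -St; apply: le_lt_trans (search_lip S _ h1) _; last by lra.
by rewrite mulr_ge0// ltW.
Qed.

Lemma sampled_timeP g x S : (sampled_time g x S < +oo)%E -> 0 < g ->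
  exists2 i : nat, sampled_time g x S = (i%:R * g)%:E & dist (S (i%:R * g)) x < g.
Proof.
move=> fin g0; pose ok i := dist (S (i%:R * g)) x < g.
have [exi|noi] := pselect (exists i, ok i); last first.
  move: fin; rewrite (_ : sampled_time g x S = +oo%E) ?ltxx//; apply/eqP.
  rewrite -leye_eq; apply: le_ereal_inf_tmp => _ [i _ <-].
  by case: ifP => // ?; exfalso; apply: noi; exists i.
case: (ex_minnP exi) => i oki mini; exists i => //; apply/eqP; rewrite eq_le; apply/andP; split.
  by apply: ereal_inf_lbound; exists i => //=; rewrite ifT.
apply: le_ereal_inf_tmp => _ [j _ <-]; case: ifP => [/mini ij|_]; last exact: leey.
by rewrite lee_fin ler_pM2r// ler_nat.
Qed.

Lemma separated_sampled_sum (I : finType) (P : pred I) (X : I -> point Q) d g S :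
  0 < g -> 2 * g <= d -> (forall i j, P i -> P j -> i != j -> d <= dist (X i) (X j)) ->
  (((d - 2 * g) * (#|P|%:R * (#|P|%:R - 1)) / 2)%:E <= \sum_(i | P i) sampled_time g (X i) S)%E.
Proof.
move=> g0 gd Xd.
have [[i Pi inf]|fin] := pselect (exists2 i, P i & ~ (sampled_time g (X i) S < +oo)%E).
  suff -> : (\sum_(i | P i) sampled_time g (X i) S = +oo)%E by exact: leey.
  apply/eqP; rewrite -leye_eq (bigD1 i)//=; move/negP: inf; rewrite -leNgt => /le_trans; apply.
  by rewrite leeDl// sume_ge0// => j _; apply: sampled_time_ge0; exact: ltW.
have /choice[k kP] : forall i, exists k : nat, P i ->
    sampled_time g (X i) S = (k%:R * g)%:E /\ dist (S (k%:R * g)) (X i) < g.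
  move=> i; have [Pi|_] := boolP (P i); last by exists 0%N.
  have [|//|k ? ?] := @sampled_timeP g (X i) S; last by exists k.
  by apply: contrapT => ?; apply: fin; exists i.
rewrite (eq_bigr (fun i => ((k i)%:R * g)%:E)); last by move=> i /kP[].
rewrite sumEFin lee_fin -mulrA.
have k0 i : 0 <= (k i)%:R * g by rewrite mulr_ge0// ltW.
have := @separated_sum R I (fun i => (k i)%:R * g) (d - 2 * g) #|P| [set i | P i].
rewrite cardsE => /(_ erefl)[//|i j|+ _]; last first.
  by rewrite -mulrA => /le_trans; apply; rewrite le_eqVlt (eq_bigl P) ?eqxx// => i; rewrite inE.
rewrite !inE => Pi Pj ij; have [_ di] := kP _ Pi; have [_ dj] := kP _ Pj.
have := Xd _ _ Pi Pj ij; have := dist_triangle Qc (S ((k i)%:R * g)) (X i) (X j).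
have := dist_triangle Qc (S ((k j)%:R * g)) (S ((k i)%:R * g)) (X j).
have := search_lip_abs S (k0 i) (k0 j).
by rewrite (dist_sym Qc (X i) (S _)); lra.
Qed.

Section Ratio.
Variables (s : randomized_search Q) (c : R).
Hypothesis c0 : 0 < c.
Hypothesis sc : (competitive_ratio_of s <= c%:E)%E.

Lemma sampled_expectation g x : 0 < g -> 0 < depth x ->
  (\int[s]_S sampled_time g x S <= (c * depth x)%:E)%E.
Proof.
move=> g0 x0.
have : (\int[s]_S (sampled_time g x S * ((depth x)^-1)%:E) <= c%:E)%E.
  apply: le_trans sc; apply: le_trans (_ : expected_normalized_time s x <= _)%E; last first.
    by apply: ereal_sup_ubound; exists x.
  apply: le_nonneg_integral => S.
    by rewrite mule_ge0 ?sampled_time_ge0 ?lee_fin ?invr_ge0// ltW.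
  rewrite /normalized_search_time asboolF; last first.
    by move=> xO; rewrite xO depthO// ltxx in x0.
  by apply: lee_wpmul2r; [rewrite lee_fin invr_ge0 ltW|exact: sampled_time_le].
rewrite ge0_integralZr//; last 3 first.
- exact: (measurable_sampled_time _ (ltW g0)).
- by move=> S _; apply: sampled_time_ge0; exact: ltW.
- by rewrite lee_fin invr_ge0 ltW.
by rewrite lee_pdivrMr// EFinM.
Qed.

(** The expected search times of the [m] points add up to at least
    [d * m * (m - 1) / 2]; this quadratic bound in [d * m] is replaced by its
    tangent at [a + d / 2], which makes it linear in the number of points. *)
Lemma separated_points_bound (I : finType) (P : pred I) (X : I -> point Q) d a :
  0 < d -> (forall i, P i -> 0 < depth (X i)) ->
  (forall i j, P i -> P j -> i != j -> d <= dist (X i) (X j)) ->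
  d * \sum_(i | P i) (a - c * depth (X i)) <= (a + d / 2) ^+ 2 / 2.
Proof.
move=> d0 X0 Xd; pose m : R := #|P|%:R.
have m0 : 0 <= m * (m - 1).
  rewrite /m; case: #|P| => [|n]; first by rewrite mul0r.
  by rewrite -natr1 addrK mulr_ge0// addr_ge0.
have H : d * (m * (m - 1)) / 2 <= c * \sum_(i | P i) depth (X i).
  have Hg g : 0 < g -> 2 * g <= d -> (d - 2 * g) * (m * (m - 1)) / 2 <= c * \sum_(i | P i) depth (X i).
    move=> g0 gd; rewrite -lee_fin mulr_sumr -sumEFin.
    apply: (@le_trans _ _ (\sum_(i | P i) \int[s]_S sampled_time g (X i) S)%E); last first.
      by apply: lee_sum => i Pi; apply: sampled_expectation => //; exact: X0.
    rewrite -big_filter -ge0_integral_sum//; last 2 first.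
    - by move=> i; exact: (measurable_sampled_time _ (ltW g0)).
    - by move=> i S _; apply: sampled_time_ge0; exact: ltW.
    rewrite -[leLHS]mule1 -(probability_setT s) -integral_cst//.
    apply: le_nonneg_integral => S /=; last by rewrite big_filter; exact: separated_sampled_sum.
    by rewrite lee_fin -mulrA mulr_ge0 ?divr_ge0// subr_ge0.
  apply/ler_addgt0Pr => e e0; pose B := m * (m - 1).
  pose g := Num.min (d / 2) (e / (B + 1)).
  have [g0 gd ge] : [/\ 0 < g, g <= d / 2 & g <= e / (B + 1)].
    by rewrite /g lt_min !ge_min !lexx orbT !divr_gt0//; rewrite /B; lra.
  have {}ge : g * B <= e.
    by rewrite ler_pdivlMr in ge; [rewrite /B in ge *; lra|rewrite /B; lra].
  have gd2 : 2 * g <= d by lra.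
  have := Hg g g0 gd2; rewrite -/B => ?; lra.
have sumE : \sum_(i | P i) (a - c * depth (X i)) = m * a - c * \sum_(i | P i) depth (X i).
  rewrite big_split /= sumrN -mulr_sumr; congr (_ - _).
  by rewrite /m mulr_natl -sumr_const; apply: eq_bigl.
rewrite sumE.
have : 0 <= (d * m - a - d / 2) ^+ 2 by exact: sqr_ge0.
have : d * (d * (m * (m - 1)) / 2) <= d * (c * \sum_(i | P i) depth (X i)) by rewrite ler_pM2l.
rewrite !expr2; lra.
Qed.

End Ratio.
End LowerBound.


Section Consequences.
Variables (R : realType) (Q : metric_graph R).
Hypothesis Qc : connected_graph Q.
Variables (s : randomized_search Q) (c : R).
Hypothesis c0 : 0 < c.
Hypothesis sc : (competitive_ratio_of s <= c%:E)%E.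

Let tail_small (x e : R) : 0 < x -> 0 < e -> exists n : nat, forall k, (n <= k)%N -> x / k.+1%:R <= e.
Proof.
move=> x0 e0; have /andP[_ h] := truncn_itv (ltW (divr_gt0 x0 e0)).
exists (Num.truncn (x / e)) => k nk; rewrite ler_pdivrMr// mulrC -ler_pdivrMr//.
by apply: le_trans (ltW h) _; rewrite ler_nat ltnS.
Qed.

(** Points along a ray without an end point would be reached at times that tend to
    infinity in every search, because a searcher that reaches them at bounded times
    converges to an end point; by Fatou's lemma the expected times are then
    unbounded, although the depths are not. *)
Lemma finite_ratio_rays_end : rays_end Q.
Proof.
move=> f l l0 fO fd.
pose u (n : nat) := l - l / n.+2%:R.
have u_lt n : 0 < u n < l.
  rewrite /u subr_gt0 ltrBlDr ltrDl divr_gt0// andbT.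
  by rewrite ltr_pdivrMr// ltr_pMr// ltr1n.
have uf n : depth (f (u n)) = u n.
  have /andP[u0 ul] := u_lt n.
  by rewrite /depth -fO fd ?subr0// ltW.
pose g (n : nat) : R := n.+1%:R^-1.
have g0 n : 0 < g n by rewrite invr_gt0.
pose T n (S : search_space Q) : \bar R := sampled_time (g n) (f (u n)) S.
have mT n : measurable_fun setT (T n) by exact: (measurable_sampled_time _ (ltW (g0 n))).
have T0 n S : (0 <= T n S)%E by exact: (sampled_time_ge0 _ _ (ltW (g0 n))).
have ET n : (\int[s]_S T n S <= (c * l)%:E)%E.
  have /andP[u0 ul] := u_lt n.
  apply: le_trans (sampled_expectation Qc sc (g0 n) _) _; rewrite uf//.
  by rewrite lee_fin ler_pM2l// ltW.
have [S finS] : exists S, (limn_einf (T ^~ S) < +oo)%E.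
  apply: contrapT => H.
  have : (\int[s]_S limn_einf (T ^~ S) <= (c * l)%:E)%E.
    apply: le_trans (fatou _ _ _ _) _ => //.
    rewrite limn_einf_lim; apply: lime_le; first exact: is_cvg_einfs.
    by apply: nearW => n; apply: ge_ereal_inf; exists (\int[s]_S T n S)%E => //; exists n => //=.
  rewrite (_ : (fun S => limn_einf (T ^~ S)) = cst +oo%E); last first.
    apply/funext => S /=; apply/eqP; rewrite -leye_eq leNgt; apply/negP => ?.
    by apply: H; exists S.
  by rewrite integral_cst// [X in (_ * X)%E](probability_setT s) mule1 leye_eq.
have [M HM] : exists M : R, forall n, exists2 k, (n <= k)%N &
    exists2 t, 0 <= t <= M & dist (S t) (f (u k)) < g k.
  have [M SM] : exists M : R, (limn_einf (T ^~ S) < M%:E)%E.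
    case: (limn_einf _) finS => [x| |] // _; last by exists 0; exact: ltNyr.
    by exists (x + 1); rewrite lte_fin ltrDl.
  exists M => n; have : (einfs (T ^~ S) n < M%:E)%E.
    apply: le_lt_trans SM; rewrite limn_einf_lim (cvg_lim _ (@cvg_einfs_sup _ _))//.
    by apply: ereal_sup_ubound; exists n.
  move=> /ereal_inf_lt[_ [k /= nk <-] Tk]; exists k => //.
  have [i iE di] := sampled_timeP (lt_trans Tk (ltry _)) (g0 k).
  exists (i%:R * g k) => //; rewrite mulr_ge0 ?(ltW (g0 k))//=.
  by rewrite -lee_fin -iE ltW.
(* [tau] is the largest cluster point of the times, bounded by [M], at which the search is
   near the points of the ray. *)
pose E := [set a : R | forall n, exists2 k, (n <= k)%N &
  exists2 t, a <= t <= M & 0 <= t /\ dist (S t) (f (u k)) < g k].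
pose tau := sup E.
have E0 : E 0.
  move=> n; have [k nk [t /andP[t0 tM] d]] := HM n.
  by exists k => //; exists t; rewrite ?t0.
have ubE : has_ubound E.
  by exists M => a Ea; have [k _ [t /andP[at_ tM] _]] := Ea 0%N; exact: le_trans tM.
have tau0 : 0 <= tau by exact: ub_le_sup.
have near_tau e : 0 < e -> forall n, exists2 k, (n <= k)%N & dist (S tau) (f (u k)) < e.
  move=> e0 n; have e20 : 0 < e / 2 by rewrite divr_gt0.
  have [a Ea aE] : exists2 a, E a & tau - e / 2 < a.
    by apply: sup_gt; [exists 0|rewrite ltrBlDr ltrDl].
  have /existsNP[n0 Hn0] : ~ E (tau + e / 2).
    by move=> /(ub_le_sup ubE); rewrite leNgt ltrDl e20.
  have [n1 Hn1] := tail_small ltr01 e20.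
  have [k nk [t /andP[at_ tM] [t0 d]]] := Ea (maxn n (maxn n0 n1)).
  move: nk; rewrite !geq_max => /and3P[nk n0k n1k]; exists k => //.
  have tt : t < tau + e / 2.
    rewrite ltNge; apply/negP => le; apply: Hn0; exists k => //; exists t => //.
    by rewrite le.
  have := dist_triangle Qc (S t) (S tau) (f (u k)); have := search_lip_abs Qc S tau0 t0.
  have : `|tau - t| < e / 2 by rewrite ltr_norml; apply/andP; split; lra.
  have := Hn1 k n1k; rewrite div1r -/(g k); lra.
exists (S tau) => a a0 al.
have near e : 0 < e -> exists2 v, a <= v < l /\ l - v <= e & dist (S tau) (f v) < e.
  move=> e0; have me : 0 < Num.min e (l - a) by rewrite lt_min e0 subr_gt0.
  have [n1 Hn1] := tail_small l0 me; have [k n1k dk] := near_tau e e0 n1.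
  exists (u k) => //; have /andP[u0 ul] := u_lt k; have := Hn1 k.+1 (leqW n1k).
  rewrite le_min => /andP[h1 h2]; rewrite ul andbT /u; set w := l / _ in h1 h2 *; split; lra.
have dv v : a <= v < l -> dist (f a) (f v) = v - a by move=> /andP[av vl]; rewrite fd.
apply/eqP; rewrite eq_le; apply/andP; split; apply/ler_addgt0Pr => e e0.
  have [v [avl _] d] := near e e0; have /andP[_ vl] := avl.
  have := dist_triangle Qc (f v) (f a) (S tau).
  by rewrite dv// (dist_sym Qc (f v)); lra.
have [v [avl le] d] := near (e / 2) ltac:(by rewrite divr_gt0).
have := dist_triangle Qc (S tau) (f a) (f v).
by rewrite dv//; lra.
Qed.

Variable code : arc Q * bool -> nat.
Hypothesis codeI : forall h h', half_nonempty h -> half_nonempty h' ->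
  code h = code h' -> h = h'.

Let mu := @lebesgue_measure R.

(** The sum of [r - depth x] over the sampled points [x] is the integral over [y] of the
    number of them at depth at most [y], so that it approximates the area divided by the
    spacing; take [a = c * r] in the preceding bound. *)
Lemma length_area_bound r : 0 < r ->
  (\int[mu]_(y in `[0%R, r]) length_within code y <= (c * r ^+ 2 / 2)%:E)%E.
Proof.
move=> r0.
have mL k : measurable_fun `[0%R, r] (fun y => half_length code k y : \bar R).
  by apply: measurable_funTS; exact: measurable_half_length.
rewrite /length_within integral_nneseries//.
apply: lime_le; first by apply: is_cvg_nneseries => k _ _; exact: integral_ge0.
apply: nearW => K; rewrite -ge0_integral_sum//.
apply/lee_addgt0Pr => th th0.
(* The errors [e r], [d r / 2] and [d^2 / (8 c)], where [d <= e <= 1], add up to at most [th]. *)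
pose e := Num.min 1 (th / (3 * r / 2 + 1 / (8 * c))).
have q0 : 0 < 3 * r / 2 + 1 / (8 * c) by rewrite addr_gt0 ?divr_gt0 ?mulr_gt0.
have [e0 e1 eth] : [/\ 0 < e, e <= 1 & e * (3 * r / 2 + 1 / (8 * c)) <= th].
  by rewrite /e -ler_pdivlMr// lt_min !ge_min !lexx orbT ltr01 divr_gt0.
have [d [d0 de [n [P [X [Xr Xd Xl]]]]]] := packing Qc codeI K r0 e0.
pose Z := \sum_(i | P i) (r - depth (X i)).
pose I := [seq i <- index_enum _ | P i].
pose F (y : R) : \bar R := (d%:E * \sum_(i <- I) (\1_(`[depth (X i), +oo[) y)%:E)%E.
have mI i : measurable_fun `[0%R, r] (fun y : R => (\1_(`[depth (X i), +oo[) y)%:E : \bar R).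
  by apply/measurable_EFinP/measurable_indic.
have sum0 y : (0 <= \sum_(i <- I) (\1_(`[depth (X i), +oo[) y)%:E :> \bar R)%E.
  by apply: sume_ge0 => i _; rewrite lee_fin.
have msum : measurable_fun `[0%R, r] (fun y : R => \sum_(i <- I) (\1_(`[depth (X i), +oo[) y)%:E : \bar R)%E.
  exact: emeasurable_sum.
have F0 y : (0 <= F y)%E by rewrite mule_ge0// lee_fin ltW.
have mF : measurable_fun `[0%R, r] F by exact: measurable_funeM.
have ZE : (\int[mu]_(y in `[0%R, r]) F y)%E = (d * Z)%:E.
  rewrite ge0_integralZl_EFin ?(ltW d0)//= EFinM; congr (_ * _)%E.
  rewrite ge0_integral_sum//.
  rewrite /I big_filter -sumEFin; apply: eq_bigr => i /Xr /andP[X0 X1].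
  rewrite integral_indic// (_ : _ `&` _ = `[depth (X i), r]%classic).
    rewrite [LHS](lebesgue_measure_itv `[depth (X i), r]) /= lte_fin; case: ltP => // X2.
    by rewrite (le_anti (_ : r <= depth (X i) <= r)) ?X1 ?X2// subrr.
  apply/seteqP; split=> y /=; rewrite !in_itv /= andbT; first by case=> -> /andP[].
  by move=> /andP[h1 h2]; rewrite h1 h2 (le_trans (ltW X0) h1).
apply: (@le_trans _ _ (d * Z + e * r)%:E).
  apply: (@le_trans _ _ (\int[mu]_(y in `[0%R, r]) (F y + e%:E))%E).
    apply: ge0_le_integral => //.
    - by move=> y _; apply: sume_ge0 => k _; exact: measure_ge0.
    - exact: emeasurable_sum.
    - exact: emeasurable_funD.
    move=> y /=; rewrite in_itv /= => /andP[y0 yr]; rewrite big_mkord.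
    apply: le_trans (Xl y y0 yr) _; rewrite EFinD EFinM leeD2r// /F.
    rewrite lee_pmul2l// -sumEFin /I big_filter lee_sum// => i _.
    by rewrite indicE mem_setE in_itv /= andbT.
  rewrite ge0_integralD//; last by move=> y _; rewrite lee_fin ltW.
  rewrite ZE integral_cst// EFinD leeD2l// EFinM lee_pmul2l//.
  by rewrite [leLHS](lebesgue_measure_itv `[0, r]) /= lte_fin r0 -EFinB subr0.
have bound : d * (c * Z) <= (c * r + d / 2) ^+ 2 / 2.
  have -> : c * Z = \sum_(i | P i) (c * r - c * depth (X i)).
    by rewrite /Z mulr_sumr; apply: eq_bigr => i _; rewrite mulrBr.
  by apply: (separated_points_bound Qc sc) => // i /Xr/andP[].
rewrite -EFinD lee_fin.
have b2 : d * Z <= (c * r + d / 2) ^+ 2 / 2 / c by rewrite ler_pdivlMr//; lra.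
have b3 : (c * r + d / 2) ^+ 2 / 2 / c = c * r ^+ 2 / 2 + r * d / 2 + d * d / (8 * c).
  by field; rewrite gt_eqF.
have b4 : d * d / (8 * c) <= e * (1 / (8 * c)).
  rewrite mul1r ler_pM2r ?invr_gt0 ?mulr_gt0//.
  by apply: le_trans (de); apply: ler_piMr; [exact: ltW|exact: le_trans e1].
have b5 : r * d <= r * e by rewrite ler_pM2l.
by rewrite mulrDr in eth; lra.
Qed.

End Consequences.


(** * The random radii and coins *)

Local Notation image_measure := measure_function_pushforward__canonical__measure_function_Measure.

Section Choices.
Variables (R : realType) (P : probability (choice_space R) R).
Hypothesis law : doubling_law P.

Let W := choice_space R.

Lemma measurable_radius (j : int) : measurable_fun [set: W] (fun w : W => w.1 j : measurableTypeR R).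
Proof.
move=> _ B mB; rewrite setTI; apply: sub_sigma_algebra; exists j; left.
by exists B.
Qed.

Lemma measurable_coin (j : int) (C : set bool) : measurable [set w : W | C (w.2 j)].
Proof.
have mc : measurable_fun [set: W] (fun w : W => w.2 j).
  apply: (measurable_fun_bool true); rewrite setTI; apply: sub_sigma_algebra.
  by exists j; right.
by rewrite -[X in measurable X]setTI; exact: (mc measurableT C I).
Qed.

Definition cylinders : set (set W) := [set E |
  exists (J : seq int) (B : int -> set R) (C : int -> set bool),
  [/\ uniq J, forall j, measurable (B j) &
   E = [set w : W | forall j, j \in J -> B j (w.1 j) /\ C j (w.2 j)]]].

Lemma cylindersI : setI_closed cylinders.
Proof.
move=> _ _ [J [B [C [uJ mB ->]]]] [J' [B' [C' [uJ' mB' ->]]]].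
exists (undup (J ++ J')), (fun j => (if j \in J then B j else setT) `&` (if j \in J' then B' j else setT)),
  (fun j => (if j \in J then C j else setT) `&` (if j \in J' then C' j else setT)).
split; first exact: undup_uniq.
  by move=> j; apply: measurableI; case: ifP.
apply/seteqP; split=> w /=.
  move=> [h h'] j; rewrite mem_undup mem_cat => _.
  by do 2![case: ifPn => ?]; split; split=> //; do ?[by case: (h j)|by case: (h' j)].
move=> h; split=> j jJ; have := h j; rewrite mem_undup mem_cat jJ ?orbT => /(_ isT)[] [? ?] [? ?] //.
Qed.

Lemma cylinders_measurable E : cylinders E -> measurable E.
Proof.
move=> [J [B [C [_ mB ->]]]].
elim: J => [|j J IH].
  by rewrite (_ : [set _ | _] = setT)//; apply/seteqP; split.
rewrite (_ : [set _ | _] = ([set w : W | B j (w.1 j)] `&` [set w : W | C j (w.2 j)]) `&`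
   [set w : W | forall i, i \in J -> B i (w.1 i) /\ C i (w.2 i)]).
  apply: measurableI => //; apply: measurableI; last exact: measurable_coin.
  by have := measurable_radius j measurableT (mB j); rewrite setTI.
apply/seteqP; split=> w /=.
  move=> h; split; first by apply: h; rewrite mem_head.
  by move=> i iJ; apply: h; rewrite in_cons iJ orbT.
by move=> [h1 h2] i; rewrite in_cons => /predU1P[->//|]; exact: h2.
Qed.

Lemma cylinders_generate : measurable = <<s cylinders >> :> set (set W).
Proof.
apply/seteqP; split=> E; last first.
  apply: smallest_sub; first exact: sigma_algebra_measurable.
  exact: cylinders_measurable.
apply: smallest_sub; first exact: smallest_sigma_algebra.
move=> F [j [[B mB ->]|->]]; apply: sub_sigma_algebra.
  exists [:: j], (fun=> B), (fun=> setT); split=> //; apply/seteqP; split=> w /=.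
    by move=> Bw i; rewrite inE => /eqP ->.
  by move=> /(_ j); rewrite mem_head => /(_ isT)[].
exists [:: j], (fun=> setT), (fun=> [set b : bool | b]); split=> //; apply/seteqP; split=> w /=.
  by move=> Bw i; rewrite inE => /eqP ->.
by move=> /(_ j); rewrite mem_head => /(_ isT)[].
Qed.

Definition flip (w : W) : W := (w.1, fun j => ~~ w.2 j).

Lemma measurable_flip : measurable_fun setT flip.
Proof.
apply: (@measurability _ _ W W setT flip (@choice_events R)) => // _ [_ [j [[B mB ->]|->]] <-]; rewrite setTI.
  by have := measurable_radius j measurableT mB; rewrite setTI.
exact: (measurable_coin j [set b | ~~ b]).
Qed.

Lemma flip_invariant E : measurable E -> P (flip @^-1` E) = P E.
Proof.
move=> mE; change (pushforward P flip E = P E).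
apply: (measure_unique cylinders (fun=> setT) cylinders_generate cylindersI _ _
  (image_measure P measurable_flip)) => //.
- by move=> _; exists [::], (fun=> setT), (fun=> setT); split=> //; apply/seteqP; split.
- by apply/seteqP; split=> // w _; exists 0%N.
- move=> _ [J [B [C [uJ mB ->]]]].
  have E1 := @law J B (fun j => [set b | C j (~~ b)]) uJ mB.
  apply: (etrans E1); apply/esym/(etrans (@law J B C uJ mB)).
  apply: eq_bigr => j _; congr (_ * _)%E.
  have h01 : 0 <= (2^-1 : R) <= 1 by apply/andP; split; lra.
  rewrite !(bernoulli_probE h01) !diracE.
  have -> : unstable.onem (2^-1 : R) = 2^-1 by rewrite /unstable.onem; lra.
  by rewrite addeC.
- by move=> _; change (P [set: W] < +oo)%E; rewrite [X in (X < _)%E]probability_setT ltry.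
Qed.

Lemma integral_flip (f : W -> \bar R) : measurable_fun setT f -> (forall w, 0 <= f w)%E ->
  (\int[P]_w f (flip w) = \int[P]_w f w)%E.
Proof.
move=> mf f0.
have := @ge0_integral_pushforward _ _ _ _ R flip measurable_flip P setT f measurableT mf.
move=> /(_ (fun _ _ => f0 _)) <-.
apply: (@eq_measure_integral _ _ R setT P
  (image_measure P measurable_flip) f) => A mA _.
exact: flip_invariant.
Qed.

Definition in_range (w : W) := forall j : int, 2 ^ (j - 1) <= w.1 j <= 2 ^ j.

Let fair_setT : bernoulli_prob (2^-1 : R) setT = 1%E.
Proof.
have h01 : 0 <= (2^-1 : R) <= 1 by apply/andP; split; lra.
rewrite (bernoulli_probE h01) !diracT !mule1 -EFinD; congr (_%:E).
by rewrite /unstable.onem; lra.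
Qed.

Lemma radius_law j (B : set R) : measurable B ->
  P [set w : W | B (w.1 j)] = uniform_prob (dyadic_lt R j) B.
Proof.
move=> mB; have := @law [:: j] (fun=> B) (fun=> setT) erefl (fun=> mB).
rewrite big_seq1 fair_setT mule1 => <-; congr (P _).
apply/seteqP; split=> w /=; first by move=> ? i; rewrite inE => /eqP ->.
by move=> /(_ j); rewrite mem_head => /(_ isT)[].
Qed.

Lemma radii_law k j (A B : set R) : k != j -> measurable A -> measurable B ->
  P ([set w : W | B (w.1 k)] `&` [set w : W | A (w.1 j)]) =
  (uniform_prob (dyadic_lt R k) B * uniform_prob (dyadic_lt R j) A)%E.
Proof.
move=> kj mA mB; pose F i := if i == k then B else A.
have mF i : measurable (F i) by rewrite /F; case: ifP.
have := @law [:: k; j] F (fun=> setT) _ mF; rewrite /= inE kj => /(_ isT).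
rewrite big_cons big_seq1 fair_setT !mule1 /F eqxx eq_sym (negbTE kj) => <-; congr (P _).
apply/seteqP; split=> w /=.
  move=> [Bw Aw] i; rewrite !inE => /orP[|] /eqP ->; first by rewrite eqxx.
  by rewrite eq_sym (negbTE kj).
move=> H; split.
  by have := H k; rewrite mem_head eqxx => /(_ isT)[].
by have := H j; rewrite !inE eqxx orbT eq_sym (negbTE kj) => /(_ isT)[].
Qed.

Lemma in_range_ae : {ae P, forall w, in_range w}.
Proof.
have one j : {ae P, forall w : W, 2 ^ (j - 1) <= w.1 j <= 2 ^ j}.
  pose B := `[(2 : R) ^ (j - 1), 2 ^ j]%classic.
  have mB : measurable B by exact: measurable_itv.
  have mE : measurable [set w : W | B (w.1 j)].
    by have := measurable_radius j measurableT mB; rewrite setTI.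
  exists (~` [set w : W | B (w.1 j)]); split; first exact: measurableC.
    rewrite probability_setC// radius_law// /uniform_prob integral_uniform_pdf1 ?subee//; exact: dyadic_lt.
  by move=> w /= H Bw; apply: H; move: Bw; rewrite /B /= in_itv.
have : {ae P, forall w : W, forall n : nat,
    if unpickle n is Some j then 2 ^ (j - 1) <= w.1 j <= 2 ^ j else true}.
  apply/ae_foralln => n; case: (unpickle n) => [j|]; first exact: one.
  by apply: aeW.
apply: filterS => w H j; have := H (pickle j); by rewrite pickleK.
Qed.

Lemma conditional_expectation (k j : int) (B : set R) (f : measurableTypeR R -> \bar R) : k != j ->
  measurable B -> measurable_fun setT f -> (forall x, 0 <= f x)%E ->
  (\int[P]_(w in [set w : W | B (w.1 k)]) f (w.1 j) =
   uniform_prob (dyadic_lt R k) B * \int[uniform_prob (dyadic_lt R j)]_x f x)%E.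
Proof.
move=> kj mB mf f0; set E := [set w : W | B (w.1 k)].
have mE : measurable E.
  by have := measurable_radius k measurableT mB; rewrite setTI.
pose PE := mrestr P mE.
have mX := measurable_radius j.
have fX0 w : (0 <= f (w.1 j))%E by [].
have mfX : measurable_fun setT (fun w : W => f (w.1 j)) by exact: measurableT_comp.
have -> : (\int[P]_(w in E) f (w.1 j) = \int[PE]_(w in E) f (w.1 j))%E.
  by apply: eq_measure_integral => A mA AE; change (P A = P (A `&` E)); rewrite setIidl.
have -> : (\int[PE]_(w in E) f (w.1 j) = \int[PE]_w f (w.1 j))%E.
  rewrite [RHS](ge0_negligible_integral (N := ~` E))//; first by rewrite setTD setCK.
  - exact: measurableC.
  - by change (P (~` E `&` E) = 0%E); rewrite setICl measure0.
have := @ge0_integral_pushforward _ _ W (measurableTypeR R) R _ mX PE setT f measurableT mf.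
move=> /(_ (fun _ _ => f0 _)); rewrite preimage_setT => <-.
have c0 : 0 <= fine (uniform_prob (dyadic_lt R k) B) by apply: fine_ge0; exact: measure_ge0.
have cE : uniform_prob (dyadic_lt R k) B = (fine (uniform_prob (dyadic_lt R k) B))%:E.
  by rewrite fineK// fin_num_measure.
rewrite cE -[X in (X%:E * _)%E]/((NngNum c0)%:num) -ge0_integral_mscale//.
apply: (@eq_measure_integral _ (measurableTypeR R) R setT _
  (image_measure PE mX) f) => A mA _.
change (P ([set w : W | A (w.1 j)] `&` E) = (fine (uniform_prob (dyadic_lt R k) B))%:E
  * uniform_prob (dyadic_lt R j) A)%E.
by rewrite -cE setIC; exact: radii_law.
Qed.

End Choices.


(** * One run of the doubling strategy *)

Section Average.
Variables (R : realType) (Q : metric_graph R) (s : randomized_search Q).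
Variables (P : probability (choice_space R) R) (sigma : choice_space R -> search_space Q).
Hypothesis law : doubling_law P.
Hypothesis msigma : measurable_fun setT sigma.
Hypothesis sE : forall B, measurable B -> s B = P (sigma @^-1` B).

Import HBNNSimple.

(** Only the sum of [f] over a choice and its flip is controlled by a measurable
    function, because the moments of the visits are arbitrary functions of the radii;
    the flip preserves the law, and the integral of [f] is approached by simple
    functions below [f]. *)
Lemma integral_le_flip_average (f : search Q -> \bar R) (g : choice_space R -> \bar R) :
  (forall S, 0 <= f S)%E -> measurable_fun setT g -> (forall w, 0 <= g w)%E ->
  (forall w, in_range w -> f (sigma w) + f (sigma (flip w)) <= 2%:E * g w)%E ->
  (\int[s]_S f S <= \int[P]_w g w)%E.
Proof.
move=> f0 mg g0 fg; rewrite ge0_integralTE//; apply: ge_ereal_sup => _ [h hf <-].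
have -> : sintegral s h = (\int[s]_S (h S)%:E)%E.
  by rewrite integral_nnsfun// patch_setT.
have mh : measurable_fun setT (fun S : search_space Q => (h S)%:E).
  exact/measurable_EFinP.
have h0 S : (0 <= (h S)%:E)%E by rewrite lee_fin.
have -> : (\int[s]_S (h S)%:E = \int[P]_w (h (sigma w))%:E)%E.
  have := @ge0_integral_pushforward _ _ _ _ R sigma msigma P setT _ measurableT mh.
  move=> /(_ (fun _ _ => h0 _)) <-.
  by apply: (@eq_measure_integral _ _ R setT
    (image_measure P msigma) s) => A mA _; exact: sE.
have mhs : measurable_fun setT (fun w => (h (sigma w))%:E).
  exact: (measurableT_comp mh msigma).
have mhf : measurable_fun setT (fun w => (h (sigma (flip w)))%:E).
  exact: (measurableT_comp mhs (@measurable_flip R)).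
rewrite -(@lee_pmul2l _ 2%:E)//.
have -> : (2%:E * \int[P]_w (h (sigma w))%:E = \int[P]_w ((h (sigma w))%:E + (h (sigma (flip w)))%:E))%E.
  rewrite ge0_integralD//.
  rewrite (integral_flip law (f := fun w => (h (sigma w))%:E))//.
  by rewrite mule_natl mule2n.
rewrite -ge0_integralZl//; apply: ae_ge0_le_integral => //.
- by move=> w _; rewrite adde_ge0.
- exact: emeasurable_funD.
- by move=> w _; rewrite mule_ge0.
- exact: measurable_funeM.
apply: filterS (in_range_ae law) => w rw _.
by apply: le_trans (fg w rw); apply: leeD; exact: hf.
Qed.

End Average.

Section Run.
Variables (R : realType) (Q : metric_graph R).
Variable G : set (spath Q).
Hypothesis Gt : shortest_path_tree G.

Lemma dyadic_floor (h : R) : 0 < h -> exists k : int, 2 ^ (k - 1) <= h < 2 ^ k.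
Proof.
move=> h0.
have above (x : R) : 0 <= x -> exists n : nat, x < 2 ^+ n.
  move=> x0; have /andP[_ xn] := truncn_itv x0.
  exists (Num.truncn x).+1; apply: lt_trans xn _.
  by rewrite -natrX ltr_nat ltn_expl.
have [|a ha] := above h^-1; first by rewrite invr_ge0 ltW.
have a1 : 1 <= h * 2 ^+ a by rewrite -ler_pdivrMl// mulr1 ltW.
have ex : exists n : nat, h * 2 ^+ a < 2 ^+ n by apply: above; exact: le_trans a1.
case: (ex_minnP ex) => -[|n] hn nmin; first by move: hn; rewrite expr0 ltNge a1.
have p2 : 0 < (2 : R) ^+ a by exact: exprn_gt0.
exists (n.+1%:Z - a%:Z).
have E (m : nat) : (2 : R) ^ (m%:Z - a%:Z) = 2 ^+ m / 2 ^+ a.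
  by rewrite expfzDr// -exprnN.
rewrite E ltr_pdivlMr// hn andbT.
have -> : n.+1%:Z - a%:Z - 1 = n%:Z - a%:Z by rewrite -addn1 PoszD; ring.
rewrite E ler_pdivrMr// leNgt; apply/negP => /nmin; by rewrite ltnn.
Qed.

Lemma radius_step (d : int -> R) (i j : int) : (forall j, 2 ^ (j - 1) <= d j <= 2 ^ j) ->
  i <= j -> d i <= d j.
Proof.
move=> dP; rewrite le_eqVlt => /predU1P[->//|ij].
have /andP[_ h1] := dP i; have /andP[h2 _] := dP j.
apply: le_trans h1 _; apply: le_trans h2.
by rewrite ler_eXz2l ?ltr1n//; move: ij; rewrite -lezD1 lerBrDr.
Qed.

(** The ranges of the radii make [d] nondecreasing with limit 0, so that the shells up to
    index [j] cover all positive depths below [d (j + 1)]. *)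
Lemma doubling_treeE (d : int -> R) (j : int) : (forall j, 2 ^ (j - 1) <= d j <= 2 ^ j) ->
  doubling_tree G d j = ball_tree G (d (j + 1)).
Proof.
move=> dP; have d0 i : 0 < d i.
  by have /andP[+ _] := dP i; apply: lt_le_trans; exact: exprz_gt0.
apply/seteqP; split=> p.
  case=> [p0|[i /= ij [Gp /andP[_ pd]]]].
    split; last by rewrite p0.
    have [q Gq _] := spt_onto Gt (O Q).
    apply: (spt_prefix Gt Gq); split; first by rewrite p0 plen_ge0.
    by move=> t; rewrite p0 => /le_anti <-; rewrite !pfun0.
  by split=> //; apply: lt_le_trans pd _; apply: radius_step => //; rewrite lerD2r.
move=> [Gp pd]; have [p0|p0] := ltP 0 (plen p); last first.
  by left; apply/le_anti; rewrite p0 plen_ge0.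
right; have [k /andP[k1 k2]] := dyadic_floor p0.
have sh i : d i <= plen p -> plen p < d (i + 1) -> i <= j /\ shell G d i p.
  move=> h1 h2; split; last by split=> //; rewrite h1.
  rewrite leNgt; apply/negP => ji.
  have : d (j + 1) <= d i by apply: radius_step => //; rewrite lezD1.
  by rewrite leNgt (le_lt_trans h1 pd).
have [lt|le] := ltP (plen p) (d k).
  have [||? ?] := sh (k - 1); [|by rewrite subrK|by exists (k - 1)].
  by apply: le_trans k1; have /andP[] := dP (k - 1).
have [//||? ?] := sh k; last by exists k.
by apply: lt_le_trans k2 _; have /andP[+ _] := dP (k + 1); rewrite addrK.
Qed.

Lemma start_sum (start dur : int -> R) (j : int) (m : nat) :
  (forall j, start (j + 1) = start j + dur j) ->
  start j = start (j - m%:Z) + \sum_(i < m) dur (j - 1 - i%:Z).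
Proof.
move=> step; elim: m => [|m IH]; first by rewrite big_ord0 addr0 subr0.
rewrite big_ord_recr /= [LHS]IH (addrC (\sum_(i < m) _)) addrA; congr (_ + _).
have -> : j - 1 - m%:Z = j - m.+1%:Z by rewrite -addn1 PoszD; ring.
by rewrite -step; congr start; rewrite -addn1 PoszD; ring.
Qed.

Lemma start_small (start : int -> R) (j : int) e :
  (fun n : nat => start (- n%:Z)) @ \oo --> (0 : R) -> 0 < e ->
  exists m : nat, `|start (j - m%:Z)| < e.
Proof.
move=> /cvgrPdist_lt /(_ e) + e0 => /(_ e0)[n0 _ H].
pose z : int := Posz (n0 + absz j) + j.
have z0 : 0 <= z.
  by rewrite /z PoszD abszE -addrA addr_ge0// -lerBlDr sub0r -normrN ler_norm.
exists (absz z); rewrite gez0_abs//.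
have -> : j - z = - Posz (n0 + absz j) by rewrite /z; ring.
by have := H (n0 + absz j)%N (leq_addr _ _); rewrite /= sub0r normrN.
Qed.

Lemma start_ge0 (start dur : int -> R) (j : int) :
  (fun n : nat => start (- n%:Z)) @ \oo --> (0 : R) ->
  (forall j, start (j + 1) = start j + dur j) -> (forall j, 0 <= dur j) -> 0 <= start j.
Proof.
move=> cv step dur0; apply/ler_addgt0Pr => e e0.
have [m] := start_small j cv e0; rewrite (start_sum j m step) ltr_norml => /andP[h _].
have : 0 <= \sum_(i < m) dur (j - 1 - i%:Z) by apply: sumr_ge0.
lra.
Qed.

Lemma start_le (start dur : int -> R) (X : int -> \bar R) (j : int) :
  (fun n : nat => start (- n%:Z)) @ \oo --> (0 : R) ->
  (forall j, start (j + 1) = start j + dur j) -> (forall j, 0 <= dur j) ->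
  (forall j, ((dur j)%:E <= X (j + 1)%R)%E) ->
  ((start j)%:E <= \sum_(0 <= m <oo) X (j - m%:Z)%R)%E.
Proof.
move=> cv step dur0 durX; apply/lee_addgt0Pr => e e0.
have [m] := start_small j cv e0; rewrite (start_sum j m step) ltr_norml => /andP[_ h].
rewrite EFinD addeC; apply: leeD; last by rewrite lee_fin ltW.
have X0 i : (0 <= X i)%E.
  by have := durX (i - 1); rewrite subrK; apply: le_trans; rewrite lee_fin.
apply: le_trans (nneseries_lim_ge m _); last by [].
rewrite big_mkord -sumEFin; apply: lee_sum => i _.
by apply: le_trans (durX _) _; rewrite addrAC subrK.
Qed.

End Run.


(** An upper bound for the time at which round [j] starts. *)
Definition previous_rounds (R : realType) (L : R -> \bar R) (d : int -> R) (j : int) : \bar R :=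
  (\sum_(0 <= m <oo) (2%:E * L (d (j - m%:Z)%R)))%E.

(** An upper bound for the average over the coins of the time to find a point of depth [h], where
    [2^(k-1) <= h < 2^k]: the rounds before [k - 1] and half of round [k - 1], completed by
    its other half and half of round [k] if [h] is beyond the radius of round [k - 1]. *)
Definition search_cost (R : realType) (L : R -> \bar R) (k : int) (h : R)
    (w : choice_space R) : \bar R :=
  (previous_rounds L w.1 (k - 1)%R + L (w.1 k) +
   (if (w.1 k <= h)%R then L (w.1 k) else 0) +
   (if (w.1 k <= h)%R then L (w.1 (k + 1)%R) else 0))%E.

Section Cost.
Variables (R : realType) (Q : metric_graph R) (N : nat).
Hypothesis Qc : connected_graph Q.
Hypothesis Qn : levels_bounded_by Q N.
Hypothesis Qe : rays_end Q.
Variable code : arc Q * bool -> nat.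
Hypothesis codeI : forall h h', half_nonempty h -> half_nonempty h' ->
  code h = code h' -> h = h'.
Variable G : set (spath Q).
Hypothesis Gt : shortest_path_tree G.

Let L := length_within code.

Let L0 r : (0 <= L r)%E. Proof. exact: length_within_ge0. Qed.

Lemma previous_rounds_ge0 d j : (0 <= previous_rounds L d j)%E.
Proof. by apply: nneseries_ge0 => m _ _; rewrite mule_ge0. Qed.

Lemma previous_roundsS d j :
  previous_rounds L d j = (2%:E * L (d j) + previous_rounds L d (j - 1)%R)%E.
Proof.
have X0 m : (0 <= 2%:E * L (d (j - Posz m)%R))%E by rewrite mule_ge0.
pose F m := (2%:E * L (d (j - Posz m)%R))%E.
have F0 m : (0 <= F m)%E by exact: X0.
have shift m : F (m + 1)%N = (2%:E * L (d (j - 1 - Posz m)%R))%E.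
  by rewrite /F; congr (_ * L (d _))%E; rewrite PoszD; ring.
have F00 : F 0%N = (2%:E * L (d j))%E by rewrite /F subr0.
have tail : (\sum_(1 <= m <oo) F m)%E = previous_rounds L d (j - 1).
  by rewrite -(@nneseries_addn R F 1%N F0); apply: eq_eseriesr => m _; exact: shift.
have := @nneseries_split R F 0%N 1%N (fun m _ => F0 m).
by rewrite add0n big_nat1 F00 tail.
Qed.

Section OneRun.
Variables (d : int -> R) (tw : int -> tour Q).
Hypothesis dP : forall j, 2 ^ (j - 1) <= d j <= 2 ^ j.
Hypothesis twP : forall j, depth_first_tour (ball_tree G (d (j + 1))) (tw j).

Let d0 j : 0 < d j.
Proof. by have /andP[+ _] := dP j; apply: lt_le_trans; exact: exprz_gt0. Qed.

Lemma performed_time (coin : int -> bool) (S : search Q) H (j : int) t :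
  performs (fun j => if coin j then tw j else reverse_tour (tw j)) S ->
  0 <= t <= (tw j).1 -> pend ((tw j).2 t) = H ->
  (search_time S H <= previous_rounds L d j + (if coin j then t else (tw j).1 - t)%:E)%E.
Proof.
move=> [start [cv step run]] /andP[t0 t1] tH.
have dur i : (if coin i then tw i else reverse_tour (tw i)).1 = (tw i).1 by case: ifP.
have step' i : start (i + 1) = start i + (tw i).1 by rewrite step dur.
have dur0 i : 0 <= (tw i).1 by exact: dft_dur (twP i).
have durX i : ((tw i).1%:E <= 2%:E * L (d (i + 1)%R))%E.
  exact: (tour_duration Qc Qn codeI Gt (d0 (i + 1)) (twP i)).
set t' := if coin j then t else (tw j).1 - t.
have t'P : 0 <= t' <= (tw j).1.
  by rewrite /t'; case: ifP => _; apply/andP; split; lra.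
have s0 := start_ge0 j cv step' dur0.
apply: (@le_trans _ _ (start j + t')%:E); last first.
  by rewrite EFinD leeD2r//; exact: (start_le (X := fun i => (2%:E * L (d i))%E)) cv step' dur0 durX.
apply: ereal_inf_lbound; exists (start j + t') => //; split.
  by rewrite addr_ge0//; case/andP: t'P.
have := run j t'; rewrite dur => /(_ t'P) ->; rewrite -tH /t'.
by case: ifP => _ //=; rewrite opprB addrC subrK.
Qed.

Lemma two_runs (coin : int -> bool) (S S' : search Q) H (j : int) :
  performs (fun j => if coin j then tw j else reverse_tour (tw j)) S ->
  performs (fun j => if ~~ coin j then tw j else reverse_tour (tw j)) S' ->
  depth H < d (j + 1) ->
  (search_time S H + search_time S' H <= 2%:E * (previous_rounds L d j + L (d (j + 1)%R)))%E.
Proof.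
move=> pS pS' Hd; have [q Gq qH] := spt_onto Gt H.
have Bq : ball_tree G (d (j + 1)) q by split=> //; rewrite -depth_pend// qH.
have [t tS tq] := tour_visits Qc Qn Gt Qe (d0 (j + 1)) (twP j) Bq.
have tH : pend ((tw j).2 t) = H by rewrite tq.
have h1 := performed_time pS tS tH.
have h2 := performed_time (coin := fun j => ~~ coin j) pS' tS tH.
apply: le_trans (leeD h1 h2) _.
rewrite addeACA -EFinD ge0_muleDr ?previous_rounds_ge0//.
rewrite mule_natl mule2n; apply: leeD => //.
have -> : (if coin j then t else (tw j).1 - t) + (if ~~ coin j then t else (tw j).1 - t) = (tw j).1.
  by case: (coin j) => /=; ring.
exact: (tour_duration Qc Qn codeI Gt (d0 (j + 1)) (twP j)).
Qed.

End OneRun.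

Lemma search_time_ge0 (S : search Q) H : (0 <= search_time S H)%E.
Proof. by apply: le_ereal_inf_tmp => _ [t [t0 _] <-]; rewrite lee_fin. Qed.

(** The point is visited in the first round whose tree contains it, which is round
    [k - 1] or [k].  Flipping the coins reverses the tour of that round, so that the
    times of the two visits, counted from the start of the round, add up to the
    duration of the tour. *)
Lemma flipped_runs_cost (tau : int -> set (spath Q) -> tour Q) (w : choice_space R)
    (S S' : search Q) H (k : int) :
  in_range w ->
  (forall j, depth_first_tour (doubling_tree G w.1 j) (tau j (doubling_tree G w.1 j))) ->
  performs (fun j => if w.2 j then tau j (doubling_tree G w.1 j)
                     else reverse_tour (tau j (doubling_tree G w.1 j))) S ->
  performs (fun j => if ~~ w.2 j then tau j (doubling_tree G w.1 j)
                     else reverse_tour (tau j (doubling_tree G w.1 j))) S' ->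
  2 ^ (k - 1) <= depth H < 2 ^ k ->
  (search_time S H + search_time S' H <= 2%:E * search_cost L k (depth H) w)%E.
Proof.
move=> rw dfS pS pS' /andP[k1 k2].
have twP j : depth_first_tour (ball_tree G (w.1 (j + 1))) (tau j (doubling_tree G w.1 j)).
  by rewrite -doubling_treeE.
rewrite /search_cost.
have [le|lt] := leP (w.1 k) (depth H).
  apply: le_trans (two_runs (j := k) rw twP pS pS' _) _.
    have /andP[+ _] := rw (k + 1); rewrite addrK; exact: lt_le_trans.
  rewrite lee_pmul2l// previous_roundsS mule_natl mule2n.
  have perm (x y z : \bar R) : (x + x + y + z <= y + x + x + z)%E by rewrite (addeC (x + x)%E) addeA.
  exact: perm.
apply: le_trans (two_runs (j := k - 1) rw twP pS pS' _) _; rewrite subrK//.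
by rewrite !adde0.
Qed.

End Cost.


(** * The expected cost *)

Section Expectation.
Variables (R : realType) (P : probability (choice_space R) R).
Hypothesis law : doubling_law P.
Variables (L : measurableTypeR R -> \bar R) (c : R).
Hypothesis L0 : forall r, (0 <= L r)%E.
Hypothesis mL : measurable_fun setT L.
Hypothesis c0 : 0 < c.

Let mu := @lebesgue_measure R.

Hypothesis L_area : forall r, 0 < r ->
  (\int[mu]_(y in `[0%R, r]) L y <= (c * r ^+ 2 / 2)%:E)%E.

Let area r : R := fine (\int[mu]_(y in `[0%R, r]) L y)%E.

Let areaE r : 0 < r -> (\int[mu]_(y in `[0%R, r]) L y)%E = (area r)%:E.
Proof.
move=> r0; rewrite /area fineK// ge0_fin_numE; last exact: integral_ge0.
by apply: le_lt_trans (L_area r0) _; exact: ltry.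
Qed.

Let area_le r : 0 < r -> area r <= c * r ^+ 2 / 2.
Proof. by move=> r0; rewrite -lee_fin -areaE// L_area. Qed.

Let integral_area a b : 0 < a -> a <= b ->
  (\int[mu]_(y in `[a, b]) L y)%E = (area b - area a)%:E.
Proof.
move=> a0 ab; have b0 : 0 < b by exact: lt_le_trans ab.
have E : (\int[mu]_(y in `[0%R, b]) L y = \int[mu]_(y in `[0%R, a]) L y + \int[mu]_(y in `]a, b]) L y)%E.
  rewrite -ge0_integral_setU//=.
  - by rewrite -itv_bndbnd_setU// bnd_simp ltW.
  - exact: measurable_funTS.
  - by apply/disj_set2P; apply/seteqP; split=> // y [] /=; rewrite !in_itv /= => /andP[_ h1] /andP[h2 _]; rewrite ltNge h1 in h2.
have -> : (\int[mu]_(y in `[a, b]) L y = \int[mu]_(y in `]a, b]) L y)%E.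
  by rewrite integral_itv_obnd_cbnd//; exact: measurable_funTS.
move: E; rewrite !areaE//; case: (\int[mu]_(y in _) _)%E => [x| |] //= [->].
by congr (_%:E); lra.
Qed.

Let mX (j : int) : measurable_fun setT (fun w : choice_space R => L (w.1 j)).
Proof. by apply: (measurableT_comp mL); exact: measurable_radius. Qed.

Let half_dyadic (j : int) : 2 ^ (j - 1) = 2 ^ j / 2 :> R.
Proof. by rewrite expfzDr// ; congr (_ * _). Qed.

Let dyadic_gt0 (j : int) : 0 < 2 ^ j :> R. Proof. exact: exprz_gt0. Qed.

Let uniform_mean (j : int) (f : measurableTypeR R -> \bar R) :
  measurable_fun setT f -> (forall x, 0 <= f x)%E ->
  (\int[uniform_prob (dyadic_lt R j)]_x f x =
   (2 / 2 ^ j)%:E * \int[mu]_(x in `[(2 ^ j / 2)%R, (2 ^ j)%R]) f x)%E.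
Proof.
move=> mf f0; rewrite integral_uniform// half_dyadic; congr (_%:E * _)%E.
by have := dyadic_gt0 j => ?; field; rewrite gt_eqF.
Qed.

Let mean (j : int) (f : measurableTypeR R -> \bar R) :
  measurable_fun setT f -> (forall x, 0 <= f x)%E ->
  (\int[P]_w f (w.1 j) = (2 / 2 ^ j)%:E * \int[mu]_(x in `[(2 ^ j / 2)%R, (2 ^ j)%R]) f x)%E.
Proof.
move=> mf f0; have kj : j + 1 != j by rewrite -subr_eq0 addrAC subrr add0r.
have := @conditional_expectation R P law (j + 1) j setT f kj measurableT mf f0.
rewrite (_ : [set w : choice_space R | setT (w.1 (j + 1))] = setT); last by apply/seteqP; split.
move=> ->; rewrite [X in (X * _)%E](_ : _ = 1%E); last exact: probability_setT.
by rewrite mul1e uniform_mean.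
Qed.

(* Summation by parts: the coefficients [w m] double at each step, so that the
   coefficients of the [a m] are nonnegative except for the last one, whose term is
   dropped; the bounds on [a m] with [m > 0] contribute a geometric series. *)
Let sum_bound (y : R) (a : nat -> R) (M : nat) : 0 < y ->
  (forall m, 0 <= a m) -> (forall m, a m <= c * (y / 2 ^+ m.+1) ^+ 2 / 2) ->
  \sum_(m < M) 2 * (2 / (y / 2 ^+ m.+1)) * (a m - a m.+1) <= 8 / y * a 0%N + c * y / 2.
Proof.
move=> y0 a0 ac; pose w m : R := 8 * 2 ^+ m / y.
have w0 m : 0 < w m by rewrite divr_gt0// mulr_gt0// exprn_gt0.
have -> : \sum_(m < M) 2 * (2 / (y / 2 ^+ m.+1)) * (a m - a m.+1) = \sum_(m < M) w m * (a m - a m.+1).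
  by apply: eq_bigr => m _; congr (_ * _); rewrite /w exprS; field; rewrite !gt_eqF ?exprn_gt0.
case: M => [|M].
  rewrite big_ord0; apply: addr_ge0; first by apply: mulr_ge0 => //; apply: divr_ge0 => //; exact: ltW.
  by apply: divr_ge0 => //; apply: mulr_ge0; exact: ltW.
suff : \sum_(m < M.+1) w m * (a m - a m.+1) + w M * a M.+1 <=
    8 / y * a 0%N + c * y / 2 * (1 - (2 ^+ M)^-1).
  have : 0 <= w M * a M.+1 by rewrite mulr_ge0// ltW.
  have : 0 <= c * y / 2 * (2 ^+ M)^-1.
    apply: mulr_ge0; last by rewrite invr_ge0 exprn_ge0.
    by apply: divr_ge0 => //; apply: mulr_ge0; exact: ltW.
  by rewrite mulrBr mulr1; lra.
elim: M => [|M IH].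
  by rewrite big_ord_recr big_ord0 /= /w expr0 invr1 subrr mulr0 mulr1; lra.
rewrite big_ord_recr /=.
have wS : w M.+1 = 2 * w M by rewrite /w exprS; field; rewrite gt_eqF.
have wa : w M * a M.+1 <= c * y / 2 * (2 ^+ M.+1)^-1.
  apply: le_trans (_ : w M * (c * (y / 2 ^+ M.+2) ^+ 2 / 2) <= _).
    by rewrite ler_pM2l.
  have p0 : 0 < (2 : R) ^+ M by exact: exprn_gt0.
  rewrite le_eqVlt; apply/orP; left; apply/eqP; rewrite /w !exprS; field.
  by rewrite !gt_eqF.
have iS : (2 ^+ M)^-1 = 2 * (2 ^+ M.+1)^-1 :> R.
  by rewrite exprS; field; rewrite gt_eqF ?exprn_gt0.
move: IH; rewrite wS iS !mulrBr !mulr1; lra.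
Qed.

Let le_h (k : int) h := [set w : choice_space R | w.1 k <= h].

Let m_le_h k h : measurable (le_h k h).
Proof.
have := measurable_radius k measurableT (measurable_itv `]-oo, h]); rewrite setTI.
congr measurable; apply/seteqP; split=> w /=; by rewrite in_itv.
Qed.

Let m_if k h (f : choice_space R -> \bar R) : measurable_fun setT f ->
  measurable_fun setT (fun w : choice_space R => if (w.1 k <= h)%R then f w else 0%E).
Proof.
move=> mf; apply: measurable_fun_ifT => //.
by apply: (measurable_fun_bool true); rewrite setTI; exact: m_le_h.
Qed.

Let m_previous k : measurable_fun setT (fun w : choice_space R =>
  \sum_(0 <= m <oo) (2%:E * L (w.1 (k - 1 - Posz m)%R)))%E.
Proof.
have := @ge0_emeasurable_sum _ (choice_space R) R setT
  (fun m w => 2%:E * L (w.1 (k - 1 - Posz m)%R))%E xpredT.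
apply=> [m w _ _|m _]; first by rewrite mule_ge0.
by apply: measurable_funeM; exact: mX.
Qed.

Let previous0 k (w : choice_space R) :
  (0 <= \sum_(0 <= m <oo) (2%:E * L (w.1 (k - 1 - Posz m)%R)))%E.
Proof. by apply: nneseries_ge0 => m _ _; rewrite mule_ge0. Qed.

Let expected_previous k : (\int[P]_w \sum_(0 <= m <oo) (2%:E * L (w.1 (k - 1 - Posz m)%R)) <=
  (8 / 2 ^ k * area (2 ^ k / 2) + c * 2 ^ k / 2)%:E)%E.
Proof.
set y : R := 2 ^ k; have y0 : 0 < y by exact: dyadic_gt0.
have yE m : 2 ^ (k - 1 - Posz m) = y / 2 ^+ m.+1 :> R.
  have -> : k - 1 - Posz m = k - m.+1%:Z by rewrite -addn1 PoszD; ring.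
  by rewrite expfzDr// -exprnN.
have ym m : 0 < y / 2 ^+ m.+1 by rewrite divr_gt0// exprn_gt0.
rewrite integral_nneseries//; last 2 first.
- by move=> m; apply: measurable_funeM; exact: mX.
- by move=> m w _; rewrite mule_ge0.
apply: lime_le.
  by apply: is_cvg_nneseries => m _ _; apply: integral_ge0 => w _; rewrite mule_ge0.
apply: nearW => M; rewrite big_mkord.
rewrite (eq_bigr (fun m : 'I_M => (2 * (2 / (y / 2 ^+ m.+1)) * (area (y / 2 ^+ m.+1) - area (y / 2 ^+ m.+2)))%:E)); last first.
  move=> m _; rewrite ge0_integralZl//.
  rewrite mean// yE (_ : y / 2 ^+ m.+1 / 2 = y / 2 ^+ m.+2); last first.
    by rewrite [in RHS]exprSr invfM mulrA.
  rewrite integral_area// -?EFinM ?mulrA//.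
  by rewrite ler_pM2l// lef_pV2 ?posrE ?exprn_gt0// ler_eXn2l// ltr1n.
rewrite sumEFin lee_fin (_ : y / 2 = y / 2 ^+ 1); last by rewrite expr1.
apply: (sum_bound (a := fun m => area (y / 2 ^+ m.+1))) => // m; last exact: area_le.
by rewrite /area; apply: fine_ge0; exact: integral_ge0.
Qed.

Let int_add (f g : choice_space R -> \bar R) : measurable_fun setT f -> measurable_fun setT g ->
  (forall w, 0 <= f w)%E -> (forall w, 0 <= g w)%E ->
  (\int[P]_w (f w + g w) = \int[P]_w f w + \int[P]_w g w)%E.
Proof. by move=> mf mg f0 g0; rewrite ge0_integralD. Qed.

Let expected_if k h : 2 ^ k / 2 <= h -> h < 2 ^ k ->
  (\int[P]_w (if (w.1 k <= h)%R then L (w.1 k) else 0) =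
   (2 / 2 ^ k * (area h - area (2 ^ k / 2)))%:E)%E.
Proof.
move=> h1 h2; have y20 : 0 < (2 ^ k / 2 : R) by rewrite divr_gt0.
pose f (x : measurableTypeR R) : \bar R := if (x <= h)%R then L x else 0%E.
have mB : measurable (`]-oo, h]%classic : set (measurableTypeR R)) by [].
have fE : f = L \_ `]-oo, h].
  by apply/funext => x; rewrite /f patchE mem_setE in_itv.
have mf : measurable_fun setT f.
  by rewrite fE; apply/(measurable_restrictT _ mB); exact: measurable_funTS.
have f0 x : (0 <= f x)%E by rewrite /f; case: ifP.
have := mean k mf f0; rewrite {1}/f => ->.
rewrite fE -integral_mkcondr (_ : _ `&` _ = `[2 ^ k / 2, h]%classic).
  by rewrite integral_area.
apply/seteqP; split=> x /=; rewrite !in_itv /=; first by case=> /andP[-> _] ->.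
by move=> /andP[-> xh]; split; rewrite // (le_trans xh (ltW h2)).
Qed.

Let probability_le k h : 2 ^ k / 2 <= h -> h < 2 ^ k ->
  uniform_prob (dyadic_lt R k) `]-oo, h]%classic = (2 / 2 ^ k * (h - 2 ^ k / 2))%:E.
Proof.
move=> h1 h2; have mB : measurable (`]-oo, h]%classic : set (measurableTypeR R)) by [].
have -> : uniform_prob (dyadic_lt R k) `]-oo, h]%classic =
    (\int[uniform_prob (dyadic_lt R k)]_x (\1_(`]-oo, h]) x)%:E)%E.
  by rewrite integral_indic// setIT.
have mI : measurable_fun [set: measurableTypeR R] (fun x => (\1_(`]-oo, h]) x)%:E : \bar R).
  exact/measurable_EFinP/measurable_indic.
have I0 x : (0 <= (\1_(`]-oo, h]) x)%:E :> \bar R)%E by rewrite lee_fin.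
rewrite uniform_mean// integral_indic// [in RHS]EFinM; congr (_ * _)%E.
rewrite (_ : _ `&` _ = `[2 ^ k / 2, h]%classic).
  rewrite [LHS](lebesgue_measure_itv `[2 ^ k / 2, h]) /= lte_fin; case: ltP => // h3.
  by rewrite (le_anti (_ : h <= 2 ^ k / 2 <= h)) ?h3 ?h1// subrr.
apply/seteqP; split=> x /=; rewrite !in_itv /=; first by case=> -> /andP[-> _].
by move=> /andP[-> xh]; split; rewrite // (le_trans xh (ltW h2)).
Qed.

Let expected_next k h : 2 ^ k / 2 <= h -> h < 2 ^ k ->
  (\int[P]_w (if (w.1 k <= h)%R then L (w.1 (k + 1)%R) else 0) =
   (2 / 2 ^ k * (h - 2 ^ k / 2) * ((area (2 * 2 ^ k) - area (2 ^ k)) / 2 ^ k))%:E)%E.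
Proof.
move=> h1 h2; have kk : k != k + 1 by rewrite eq_sym -subr_eq0 addrAC subrr add0r.
have mB : measurable (`]-oo, h]%classic : set R) by exact: measurable_itv.
have := conditional_expectation law kk mB mL L0.
rewrite probability_le// uniform_mean// (_ : [set _ | _] = le_h k h); last first.
  by apply/seteqP; split=> w /=; rewrite in_itv.
rewrite integral_mkcond => E.
transitivity (\int[P]_w ((fun w => L (w.1 (k + 1)%R)) \_ (le_h k h)) w)%E.
  apply: eq_integral => w _; rewrite patchE; case: ifPn => wh.
    by rewrite mem_set.
  by rewrite memNset//; apply/negP.
rewrite E; have y0 := dyadic_gt0 k.
have -> : 2 ^ (k + 1) = 2 * 2 ^ k :> R by rewrite expfzDr// mulrC.
have -> : 2 * 2 ^ k / 2 = 2 ^ k :> R by field.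
rewrite integral_area//; last by lra.
rewrite -!EFinM; congr (_%:E); field; by rewrite gt_eqF.
Qed.

(** With all the areas bounded by [c r^2 / 2], the worst case is the linear length
    [c r]; there the expected cost is [c y (x^2 + 3 x + 1/2)], where [y = 2 ^ k] and
    [h = x y], which is at most [9/2 c h] for [1/2 <= x <= 1]. *)
Lemma expected_search_cost k h : 2 ^ (k - 1) <= h < 2 ^ k ->
  (\int[P]_w search_cost L k h w <= (5 * c * h)%:E)%E.
Proof.
rewrite half_dyadic => /andP[h1 h2].
have y0 : 0 < (2 ^ k : R) by exact: dyadic_gt0.
have y20 : 0 < (2 ^ k / 2 : R) by rewrite divr_gt0.
have h0 : 0 < h by exact: lt_le_trans h1.
have if0 (b : bool) r : (0 <= if b then L r else 0)%E by case: b.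
have m1 := m_previous k; have m2 := mX k.
have m3 := m_if k h (mX k); have m4 := m_if k h (mX (k + 1)).
have m12 := emeasurable_funD m1 m2; have m123 := emeasurable_funD m12 m3.
have p0 := previous0 k.
rewrite /search_cost /previous_rounds int_add//; last by move=> w; rewrite !adde_ge0.
rewrite int_add//; last by move=> w; rewrite adde_ge0.
rewrite int_add// expected_if// expected_next// mean// integral_area//; last by lra.
apply: (@le_trans _ _ ((8 / 2 ^ k * area (2 ^ k / 2) + c * 2 ^ k / 2)%:E +
   (2 / 2 ^ k)%:E * (area (2 ^ k) - area (2 ^ k / 2))%:E +
   (2 / 2 ^ k * (area h - area (2 ^ k / 2)))%:E +
   (2 / 2 ^ k * (h - 2 ^ k / 2) * ((area (2 * 2 ^ k) - area (2 ^ k)) / 2 ^ k))%:E)%E).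
  by rewrite !leeD2r// expected_previous.
rewrite -!EFinM -!EFinD lee_fin.
have b0 := area_le y20; have b1 := area_le y0; have bh := area_le h0.
have b2 : area (2 * 2 ^ k) <= c * (2 * 2 ^ k) ^+ 2 / 2 by apply: area_le; rewrite mulr_gt0.
set y := (2 ^ k : R) in h1 h2 y0 y20 b0 b1 b2 *.
set A0 := area (y / 2) in b0 *; set A1 := area y in b1 *.
set A2 := area (2 * y) in b2 *; set Ah := area h in bh *.
have -> : 8 / y * A0 + c * y / 2 + 2 / y * (A1 - A0) + 2 / y * (Ah - A0) +
    2 / y * (h - y / 2) * ((A2 - A1) / y) =
    (4 * A0 * y + c * y ^+ 3 / 2 + A1 * (3 * y - 2 * h) + 2 * Ah * y + (2 * h - y) * A2) / y ^+ 2.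
  by field; rewrite gt_eqF.
rewrite ler_pdivrMr ?exprn_gt0//.
have p0' : 0 <= 4 * y * (c * (y / 2) ^+ 2 / 2 - A0) by rewrite mulr_ge0 ?subr_ge0// mulr_ge0// ltW.
have p1 : 0 <= (3 * y - 2 * h) * (c * y ^+ 2 / 2 - A1) by rewrite mulr_ge0 ?subr_ge0//; lra.
have ph : 0 <= 2 * y * (c * h ^+ 2 / 2 - Ah) by rewrite mulr_ge0 ?subr_ge0// mulr_ge0// ltW.
have p2 : 0 <= (2 * h - y) * (c * (2 * y) ^+ 2 / 2 - A2) by rewrite mulr_ge0 ?subr_ge0//; lra.
have q : 0 <= c * y * ((y - h) * (h - y / 2)).
  by rewrite !mulr_ge0 ?subr_ge0// ?(ltW y0) ?(ltW c0) ?(ltW h2).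
have q2 : 0 <= c * y * (h * y) by rewrite !mulr_ge0// ?(ltW y0) ?(ltW c0) ?(ltW h0).
lra.
Qed.

Lemma measurable_search_cost k h : measurable_fun setT (search_cost L k h).
Proof.
apply: emeasurable_funD; last by apply: m_if; exact: mX.
apply: emeasurable_funD; last by apply: m_if; exact: mX.
exact: (emeasurable_funD (m_previous k) (mX k)).
Qed.

Lemma search_cost_ge0 k h w : (0 <= search_cost L k h w)%E.
Proof.
apply: adde_ge0; last by case: ifP.
apply: adde_ge0; last by case: ifP.
by apply: adde_ge0; [exact: previous0|exact: L0].
Qed.

End Expectation.


(** * The approximation bound *)

Lemma doubling_expected_time (R : realType) (Q : metric_graph R) (N : nat)
    (s s' : randomized_search Q) (c : R) (H : point Q) :
  connected_graph Q -> levels_bounded_by Q N -> random_doubling s ->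
  0 < c -> (competitive_ratio_of s' <= c%:E)%E ->
  (expected_normalized_time s H <= (5 * c)%:E)%E.
Proof.
move=> Qc Qn [G [tau [P [sigma [Gt law msigma run sE]]]]] c0 sc.
rewrite /expected_normalized_time /normalized_search_time.
case: asboolP => [HO|HO].
  by rewrite integral0 lee_fin mulr_ge0// ltW.
have [h0|h0] := ltP 0 (depth H); last first.
  have -> : depth H = 0 by apply/le_anti; rewrite h0 depth_ge0.
  under eq_integral do rewrite invr0 mule0.
  by rewrite integral0 lee_fin mulr_ge0// ltW.
have [code codeI] := half_code Qc Qn.
have Qe := finite_ratio_rays_end Qc c0 sc.
have [k hk] := dyadic_floor h0.
pose L : measurableTypeR R -> \bar R := length_within code.
have L0 r : (0 <= L r)%E by exact: length_within_ge0.
have mL : measurable_fun setT L by exact: measurable_length_within codeI.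
have Larea r : 0 < r -> (\int[lebesgue_measure]_(y in `[0%R, r]) L y <= (c * r ^+ 2 / 2)%:E)%E.
  exact: (length_area_bound Qc c0 sc codeI).
set h := depth H in h0 hk *; have hV0 : (0 <= (h^-1)%:E)%E by rewrite lee_fin invr_ge0 ltW.
have cost0 := search_cost_ge0 L0 k h; have mcost := measurable_search_cost L0 mL k h.
apply: (@le_trans _ _ (\int[P]_w (search_cost L k h w * (h^-1)%:E))%E).
  apply: (integral_le_flip_average law msigma sE).
  - by move=> S; rewrite mule_ge0// search_time_ge0.
  - by apply: emeasurable_funM => //; exact: measurable_cst.
  - by move=> w; rewrite mule_ge0.
  move=> w rw; rewrite -ge0_muleDl ?search_time_ge0// muleA lee_wpmul2r//.
  have [dfS pS] := run w rw; have [_ pS'] := run (flip w) rw.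
  exact: (flipped_runs_cost Qc Qn Qe codeI Gt rw dfS pS pS' hk).
rewrite ge0_integralZr//.
have Ecost := expected_search_cost law L0 mL c0 Larea hk.
apply: le_trans (lee_wpmul2r hV0 Ecost) _.
by rewrite -EFinM mulfK// gt_eqF.
Qed.

Theorem theorem19 (R : realType) (Q : metric_graph R) (N : nat)
    (Q_connected : connected_graph Q) (Q_levels : levels_bounded_by Q N)
    (s : randomized_search Q) (s_doubling : random_doubling s) :
  (competitive_ratio_of s <= 5%:R%:E * competitive_ratio Q)%E.
Proof.
have bound c : 0 < c -> (competitive_ratio Q < c%:E)%E ->
    (competitive_ratio_of s <= (5 * c)%:E)%E.
  move=> c0 /ereal_inf_lt[_ [s' _ <-] /ltW sc]; apply: ge_ereal_sup => _ [H _ <-].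
  exact: (doubling_expected_time H Q_connected Q_levels s_doubling c0 sc).
have ratio0 : (0 <= competitive_ratio Q)%E.
  apply: le_ereal_inf_tmp => _ [s' _ <-].
  apply: (@le_trans _ _ (expected_normalized_time s' (O Q))).
    apply: integral_ge0 => S _; rewrite /normalized_search_time.
    by rewrite asboolT.
  by apply: ereal_sup_ubound; exists (O Q).
case E : (competitive_ratio Q) ratio0 bound => [r| |] //; last first.
  by move=> _ _; rewrite mulry gtr0_sg// mul1e leey.
rewrite lee_fin => r0 bound; apply/lee_addgt0Pr => e e0.
rewrite -EFinM -EFinD; have -> : 5%:R * r + e = 5 * (r + e / 5) by field.
by apply: bound; [rewrite ltr_wpDl// divr_gt0|rewrite lte_fin ltrDl divr_gt0].
Qed.
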